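(* Let $k\ge 2$ be an integer and let $Z_n^{(k)}$ be the $k$-th order generalized Zagreb index of a random non-plane recursive tree of size $n$. Then $$\frac{Z_n^{(k)}-\mu_k n}{\sigma_k\sqrt{n}}\xrightarrow{\ d\ } N(0,1),\qquad n\to\infty,$$ where $\mu_k$ and $\sigma_k$ are positive constants given by $$\mu_k=2\sum_{j=2}^{\infty}\frac{b_j}{j(j+1)},\qquad \sigma_k^2=2\sum_{j=2}^{\infty}\frac{\beta_j}{j(j+1)},\quad \sigma_k>0,$$ with the sequences $(b_n)_{n\ge2}$ and $(\beta_n)_{n\ge2}$ defined in the context.
   Context: A random non-plane recursive tree of size $n$ is built as follows: start with a root labeled $1$; in step $i$ ($2\le i\le n$) the node labeled $i$ becomes a child of one of the $i-1$ existing nodes, chosen uniformly at random (independently of the past choices). The children of a node are not ordered. For a graph $G=(V,E)$, the $k$-th order generalized Zagreb index is $\sum_{v\in V}D_v^k$, where $D_v$ is the (graph) degree of $v$. $Z_n^{(k)}$ denotes this index for the random tree of size $n$ (so $Z_1^{(k)}=0$) and $R_n$ denotes the degree of the root of the same tree (so $R_1=0$). Convention: $0^0=1$. $N(0,1)$ is the standard normal distribution. Put $\mu(n)=\mathbb{E}(Z_n^{(k)})$, $\bar Z_n=Z_n^{(k)}-\mu(n)$, and for $n\ge2$ $$b_n=\sum_{\ell=0}^{k-1}\binom{k}{\ell}\frac{2}{n-1}\sum_{j=1}^{n-1}\mathbb{E}(R_j^{\ell}).$$ Let $(\tilde R_n)$ be an independent copy of $(R_n)$, and for $1\le j\le n-1$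 put $$T_{n,j}=\sum_{\ell=0}^{k-1}\binom{k}{\ell}\bigl(R_j^{\ell}+\tilde R_{n-j}^{\ell}\bigr)+\mu(j)+\mu(n-j)-\mu(n),$$ $$\beta_n=\frac1{n-1}\sum_{j=1}^{n-1}\Bigl(\mathbb{E}(T_{n,j}^2)+4\sum_{\ell=0}^{k-1}\binom{k}{\ell}\mathbb{E}(\bar Z_jR_j^{\ell})\Bigr).$$ *)

(* Defs.v *)
From HB Require Import structures.
From mathcomp Require Import all_boot all_order all_algebra.
From mathcomp Require Import all_classical all_reals all_analysis.
Set Implicit Arguments.
Unset Strict Implicit.
Unset Printing Implicit Defensive.
Import Order.TTheory GRing.Theory Num.Theory.
Import numFieldNormedType.Exports.
Local Open Scope classical_set_scope.
Local Open Scope ring_scope.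

Definition unif_mean (R : realType) (T : finType) (f : T -> R) : R :=
  (\sum_(t : T) f t) / #|T|%:R.

Definition unif_prob (R : realType) (T : finType) (A : pred T) : R :=
  #|A|%:R / #|T|%:R.

(* Convergence in distribution only involves the law of each X n, so each X n
   may live on its own (finite, uniform) probability space. *)
Definition cvg_in_distribution (R : realType) (T : nat -> finType)
    (X : forall n, T n -> R) (nu : probability (measurableTypeR R) R) : Prop :=
  forall x : R,
    {for x, continuous (fun y : R => fine (nu [set` `]-oo, y]]))} ->
    (fun n => unif_prob R (fun t : T n => X n t <= x)) @ \oo
      --> fine (nu [set` `]-oo, x]]).

Definition degree (V : finType) (e : rel V) (v : V) : nat :=
  #|[pred w | e v w]|.

Definition zagreb (V : finType) (e : rel V) (k : nat) : nat :=
  (\sum_(v : V) degree e v ^ k)%N.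

(* The node with label a (1 <= a <= n) is the ordinal of value a - 1.  The
   value of t : rrt n at i is the parent, one of the i + 1 nodes 0, ..., i
   already present, chosen by the node of value i + 1.  The uniform
   distribution on this product type is that of independent uniform choices. *)
Definition rrt (n : nat) : finType := {dffun forall i : 'I_n.-1, 'I_i.+1}.

Definition is_parent (n : nat) (t : rrt n) (v w : 'I_n) : bool :=
  [exists i : 'I_n.-1, (val w == i.+1) && (val v == t i)].

Definition rrt_adj (n : nat) (t : rrt n) : rel 'I_n :=
  fun v w => is_parent t v w || is_parent t w v.

Definition Z (k n : nat) (t : rrt n) : nat := zagreb (rrt_adj t) k.

(* The sum has exactly one term as soon as 0 < n; this form avoids casting n to
   a successor. *)
Definition root_degree (n : nat) (t : rrt n) : nat :=
  (\sum_(v < n | val v == 0) degree (rrt_adj t) v)%N.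

Section Toll.
Variables (R : realType) (k : nat).

Definition mu (n : nat) : R := unif_mean (fun t : rrt n => (Z k t)%:R).

Definition Zbar (n : nat) (t : rrt n) : R := (Z k t)%:R - mu n.

(* x ^+ 0 = 1 for every x, including x = 0. *)
Definition Rpow (l n : nat) (t : rrt n) : R := (root_degree t)%:R ^+ l.

Definition b (n : nat) : R :=
  \sum_(0 <= l < k) 'C(k, l)%:R *
    (2 / (n.-1)%:R * \sum_(1 <= j < n) unif_mean (@Rpow l j)).

(* The two components of ts are independent, and uniform on the trees of size
   j and n - j: the first carries R_j, the second the independent copy. *)
Definition toll (n j : nat) (ts : rrt j * rrt (n - j)) : R :=
  \sum_(0 <= l < k) 'C(k, l)%:R * (Rpow l ts.1 + Rpow l ts.2)
    + mu j + mu (n - j) - mu n.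

Definition beta (n : nat) : R :=
  ((n.-1)%:R)^-1 * \sum_(1 <= j < n)
    (unif_mean (fun ts : rrt j * rrt (n - j) => toll ts ^+ 2)
     + 4 * \sum_(0 <= l < k) 'C(k, l)%:R *
             unif_mean (fun t : rrt j => Zbar t * Rpow l t)).

End Toll.

(* Main.v *)
Require Import Defs.
From HB Require Import structures.
From mathcomp Require Import all_boot all_order all_algebra.
From mathcomp Require Import all_classical all_reals all_analysis.
From mathcomp Require Import measurable_realfun ring lra zify.
Import Order.TTheory GRing.Theory Num.Theory.
Import numFieldNormedType.Exports.
Local Open Scope classical_set_scope.
Local Open Scope ring_scope.
Set Implicit Arguments.
Unset Strict Implicit.
Unset Printing Implicit Defensive.

(** The proof is a contraction argument based on one decomposition of the
    random tree. Cutting the edge between the nodes 1 and 2 leaves two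
    independent random recursive trees of sizes j and n - j, with j uniform on
    1, ..., n - 1 (chain_split, mean_split). Hence Z_n is distributed as
    Z_j + Z'_(n-j) plus a toll that only depends on the two root degrees, all
    of whose moments are O(sqrt n) (root_moment).

    Taking first and second moments of this decomposition, the mean and the
    variance satisfy a_n = 2/(n-1) (a_1 + ... + a_(n-1)) + c_n with c = b and
    c = beta. This recurrence has the explicit solution
    c_n + 2 n sum_(2 <= j < n) c_j / (j (j + 1)) (split_recurrence), which yields
    E Z_n = mu_k n + O(n^(1/4)) and Var Z_n = sigma_k^2 n + O(n^(3/4)), with
    mu_k and sigma_k^2 the series of the statement (mu_asymptotics,
    variance_asymptotics).

    Positivity of sigma_k is not visible on the series, whose terms have no
    obvious sign. It comes from the growth of the tree node by node: the
    conditional expectation of a sum over nodes of a convex function of the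
    degree is again such a sum, and each growth step adds to the variance at
    least the variance of the degree of a uniform node. Hence the variance is
    at least of order n (variance_degree_sum).

    For the limit law, a function f with derivatives of sizes s, s^2, s^3 is
    integrated against the centred Z_n and against the Gaussian law of variance
    sigma_k^2 n. Expanding to second order, the difference is at most
    A s^3 n^(3/2) plus an error of smaller order (gauss_close_base). In the
    decomposition the two independent parts can be replaced one at a time by
    Gaussian variables, and a sum of independent Gaussian variables is Gaussian
    (gauss_convolution). This gives the same estimate with A replaced by the
    average of A ((j/n)^(3/2) + (1 - j/n)^(3/2)), which is at most 5 A / 6
    (gauss_close_step). Iterating, A can be taken arbitrarily small
    (gauss_close_small). With s of order n^(-1/2) this is convergence of the
    means of smooth functions of the normalized index (cvg_smooth_mean), and
    smooth approximations of indicators of half-lines conclude (zagreb_clt). *)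

(** * Growing a recursive tree by one node *)

(** The value at the last index is the parent of the new node; going through
    [inord] avoids a transport along an equality of ordinal bounds. *)
Definition grow (m : nat) (t : rrt m.+1) (a : 'I_m.+1) : rrt m.+2 :=
  [ffun i : 'I_m.+1 => inord (if unlift ord_max i is Some j then t j : nat else a)].

Definition prune (m : nat) (t : rrt m.+2) : rrt m.+1 :=
  [ffun i : 'I_m => inord (t (lift ord_max i))].

Lemma grow_lift m (t : rrt m.+1) (a : 'I_m.+1) (i : 'I_m) :
  grow t a (lift ord_max i) = t i :> nat.
Proof.
rewrite ffunE liftK inordK //.
by rewrite lift_max ltn_ord.
Qed.

Lemma grow_max m (t : rrt m.+1) (a : 'I_m.+1) : grow t a ord_max = a :> nat.
Proof. by rewrite ffunE unlift_none inordK. Qed.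

(** A tree with one more node is the same as a tree together with a parent for
    the new node, so that a uniform tree grows by a uniform choice of
    parent. *)
Lemma grow_bij m :
  bijective (fun ta : rrt m.+1 * 'I_m.+1 => grow ta.1 ta.2).
Proof.
exists (fun t : rrt m.+2 => (prune t, t ord_max)) => [[t a]|t] /=.
  congr pair; last exact/val_inj/grow_max.
  apply/ffunP => i; apply: val_inj => /=.
  by rewrite ffunE grow_lift inord_val.
apply/ffunP => i; apply: val_inj => /=.
case: (unliftP ord_max i) => [j|] ->; last by rewrite grow_max.
rewrite grow_lift ffunE inordK //.
by rewrite -[X in (_ < X.+1)%N](lift_max j) ltn_ord.
Qed.

Lemma is_parentP n (t : rrt n) (v w : 'I_n) :
  reflect (exists2 i : 'I_n.-1, val w = i.+1 & val v = t i) (is_parent t v w).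
Proof.
apply: (iffP existsP) => [[i /andP[/eqP ? /eqP ?]]|[i ? ?]]; exists i => //.
by apply/andP; split; apply/eqP.
Qed.

Lemma is_parent_grow m (t : rrt m.+1) (a : 'I_m.+1) (v w : 'I_m.+1) :
  is_parent (grow t a) (widen_ord (leqnSn _) v) (widen_ord (leqnSn _) w) = is_parent t v w.
Proof.
apply/is_parentP/is_parentP => /= -[i wi vi].
  case: (unliftP ord_max i) wi vi => [j|] ->.
    by rewrite grow_lift => wi vi; exists j; rewrite // wi lift_max.
  by move=> /= wi; have := ltn_ord w; rewrite wi ltnn.
by exists (lift ord_max i); rewrite ?lift_max ?grow_lift.
Qed.

Lemma is_parent_new m (t : rrt m.+1) (a : 'I_m.+1) (v : 'I_m.+2) :
  is_parent (grow t a) v ord_max = (v == a :> nat).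
Proof.
apply/is_parentP/eqP => /= [[i []]|va].
  case: (unliftP ord_max i) => [j|] ->.
    by move=> [jm] _; have := ltn_ord j; rewrite -[X in (X < _)%N](lift_max j) -jm ltnn.
  by rewrite grow_max.
by exists ord_max => //; rewrite grow_max.
Qed.

Lemma new_not_parent m (t : rrt m.+2) (v : 'I_m.+2) : is_parent t ord_max v = false.
Proof.
apply/negbTE/negP => /is_parentP [i vi ti]; have := ltn_ord (t i); rewrite -ti.
by have := ltn_ord v; rewrite vi /= !ltnS => ? ?; lia.
Qed.

Lemma degreeE (V : finType) (e : rel V) (v : V) : degree e v = (\sum_w e v w)%N.
Proof. by rewrite /degree -sum1_card big_mkcond. Qed.

Lemma degree_grow m (t : rrt m.+1) (a v : 'I_m.+1) :
  degree (rrt_adj (grow t a)) (widen_ord (leqnSn _) v) =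
  (degree (rrt_adj t) v + (v == a))%N.
Proof.
rewrite !degreeE big_ord_recr /=; congr addn.
  by apply: eq_bigr => w _; rewrite /rrt_adj !is_parent_grow.
by rewrite /rrt_adj is_parent_new new_not_parent orbF.
Qed.

Lemma degree_grow_new m (t : rrt m.+1) (a : 'I_m.+1) :
  degree (rrt_adj (grow t a)) ord_max = 1%N.
Proof.
rewrite degreeE big_ord_recr /= {2}/rrt_adj !new_not_parent addn0.
rewrite (bigD1 a) //= big1 => [|w wa].
  by rewrite /rrt_adj new_not_parent is_parent_new eqxx.
by rewrite /rrt_adj new_not_parent is_parent_new /= val_eqE (negbTE wa).
Qed.

(** * Uniform means and the growth chain *)

Section UniformMean.
Variables (R : realType) (T : finType).
Hypothesis T0 : (0 < #|T|)%N.
Implicit Types (f g : T -> R) (c : R).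

Let cardT_neq0 : #|T|%:R != 0 :> R.
Proof. by rewrite pnatr_eq0 -lt0n. Qed.

Lemma mean_cst c : unif_mean (fun _ : T => c) = c.
Proof. by rewrite /unif_mean sumr_const -(mulr_natr c) mulfK. Qed.

Lemma meanD f g : unif_mean (fun t => f t + g t) = unif_mean f + unif_mean g.
Proof. by rewrite /unif_mean big_split mulrDl. Qed.

Lemma meanN f : unif_mean (fun t => - f t) = - unif_mean f.
Proof. by rewrite /unif_mean sumrN mulNr. Qed.

Lemma meanB f g : unif_mean (fun t => f t - g t) = unif_mean f - unif_mean g.
Proof. by rewrite meanD meanN. Qed.

Lemma meanZ c f : unif_mean (fun t => c * f t) = c * unif_mean f.
Proof. by rewrite /unif_mean -mulr_sumr mulrA. Qed.

Lemma meanZr c f : unif_mean (fun t => f t * c) = unif_mean f * c.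
Proof. by rewrite /unif_mean -mulr_suml mulrAC. Qed.

Lemma eq_mean f g : f =1 g -> unif_mean f = unif_mean g.
Proof. by move=> fg; congr (_ / _); apply: eq_bigr. Qed.

Lemma mean_sum (I : Type) (r : seq I) (P : pred I) (F : I -> T -> R) :
  unif_mean (fun t => \sum_(i <- r | P i) F i t) = \sum_(i <- r | P i) unif_mean (F i).
Proof. by rewrite /unif_mean exchange_big mulr_suml. Qed.

Lemma ler_mean f g : (forall t, f t <= g t) -> unif_mean f <= unif_mean g.
Proof. by move=> fg; rewrite ler_wpM2r ?invr_ge0 // ler_sum. Qed.

Lemma mean_ge0 f : (forall t, 0 <= f t) -> 0 <= unif_mean f.
Proof. by move=> f0; rewrite mulr_ge0 ?invr_ge0 // sumr_ge0. Qed.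

Lemma ler_norm_mean f : `|unif_mean f| <= unif_mean (fun t => `|f t|).
Proof.
by rewrite normrM normfV [`|_%:R|]ger0_norm // ler_wpM2r ?invr_ge0 // ler_norm_sum.
Qed.

(** Nonnegativity of the quadratic polynomial in x given by the mean of (x f +
    g)^2, evaluated at its minimum. *)
Lemma mean_CauchySchwarz f g :
  unif_mean (fun t => f t * g t) ^+ 2 <=
  unif_mean (fun t => f t ^+ 2) * unif_mean (fun t => g t ^+ 2).
Proof.
set A := unif_mean (fun t => f t ^+ 2); set B := unif_mean (fun t => _ * _).
set C := unif_mean (fun t => g t ^+ 2).
have A0 : 0 <= A by apply: mean_ge0 => t; exact: sqr_ge0.
have C0 : 0 <= C by apply: mean_ge0 => t; exact: sqr_ge0.
have quad x : 0 <= A * x ^+ 2 + 2 * B * x + C.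
  suff -> : A * x ^+ 2 + 2 * B * x + C = unif_mean (fun t => (x * f t + g t) ^+ 2).
    by apply: mean_ge0 => t; exact: sqr_ge0.
  rewrite (eq_mean (g := fun t => (x ^+ 2 * f t ^+ 2 + (2 * x) * (f t * g t)) + g t ^+ 2)).
    by rewrite !meanD !meanZ -/A -/B -/C; ring.
  by move=> t; ring.
have [A_eq0|A_neq0] := eqVneq A 0.
  have [->|B0] := eqVneq B 0; first by rewrite expr0n mulr_ge0.
  have := quad (- (C + 1) / (2 * B)); rewrite A_eq0 mul0r add0r mulrC divfK; last first.
    by rewrite mulf_eq0 negb_or B0 pnatr_eq0.
  by rewrite opprD addrAC addNr add0r oppr_ge0 ler10.
have Apos : 0 < A by rewrite lt_def A_neq0.
have := quad (- B / A).
have -> : A * (- B / A) ^+ 2 + 2 * B * (- B / A) + C = (A * C - B ^+ 2) / A by field.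
by rewrite pmulr_lge0 ?invr_gt0 // subr_ge0.
Qed.

End UniformMean.

Lemma mean_prod (R : realType) (A B : finType) (F : A * B -> R) :
  unif_mean F = unif_mean (fun a => unif_mean (fun b => F (a, b))).
Proof.
rewrite /unif_mean -mulr_suml pair_bigA /= card_prod natrM invfM -mulrA [_^-1 * _]mulrC.
by congr (_ * _); apply: eq_bigr => -[].
Qed.

Lemma mean_bij (R : realType) (A B : finType) (h : A -> B) (F : B -> R) :
  bijective h -> unif_mean F = unif_mean (F \o h).
Proof. by move=> hb; rewrite /unif_mean (bij_eq_card hb) (reindex h) //; apply: onW_bij. Qed.

Lemma card_rrt_gt0 n : (0 < #|rrt n|)%N.
Proof. by apply/card_gt0P; exists [ffun i => ord0]. Qed.

Lemma mean_grow (R : realType) m (H : rrt m.+2 -> R) :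
  unif_mean H = unif_mean (fun t : rrt m.+1 => (\sum_a H (grow t a)) / m.+1%:R).
Proof.
rewrite (mean_bij H (@grow_bij m)) mean_prod; apply: eq_mean => t.
by rewrite /unif_mean card_ord.
Qed.

Section Chain.
Variable R : realType.
Implicit Types (F G : nat -> seq nat -> R).

(** A state of the growth chain is the degree of the root together with the
    degrees of the other nodes. The list stands for a multiset: only
    functionals that do not see its order describe trees. *)
Definition symmetric_in_rest F :=
  forall r s s', perm_eq s s' -> F r s = F r s'.

(** Sum over all nodes of the value of F after the new node, of degree 1, is
    attached there. Dividing by the number of nodes gives the transition
    of the chain. *)
Definition step F r s : R :=
  F r.+1 (1%N :: s) + \sum_(x <- s) F r [:: 1%N, x.+1 & rem x s].

(** Expectation of F on trees with m + 1 nodes, by backward iteration of the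
    transition, from the single node of degree 0. *)
Fixpoint chain m F : R :=
  if m is p.+1 then chain p (fun r s => step F r s / p.+1%:R) else F 0%N [::].

Lemma eq_step F G : (forall r s, F r s = G r s) -> forall r s, step F r s = step G r s.
Proof. by move=> FG r s; rewrite /step FG; congr (_ + _); apply: eq_bigr. Qed.

Lemma eq_chain m F G : (forall r s, F r s = G r s) -> chain m F = chain m G.
Proof.
elim: m F G => [|m IH] F G FG /=; first exact: FG.
by apply: IH => r s; rewrite (eq_step FG).
Qed.

Lemma chainD m F G : chain m (fun r s => F r s + G r s) = chain m F + chain m G.
Proof.
elim: m F G => [|m IH] F G //=; rewrite -IH; apply: eq_chain => r s.
by rewrite -mulrDl /step big_split addrACA.
Qed.

Lemma chainZ m c F : chain m (fun r s => c * F r s) = c * chain m F.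
Proof.
elim: m F => [|m IH] F //=; rewrite -IH; apply: eq_chain => r s.
by rewrite /step -mulr_sumr -mulrDr mulrA.
Qed.

Lemma chain0 m : chain m (fun _ _ => 0) = 0.
Proof.
rewrite -[RHS](mul0r (chain m (fun _ _ => 0))) -chainZ.
by apply: eq_chain => r s; rewrite mul0r.
Qed.

Lemma chain_sum (I : Type) (r0 : seq I) m (F : I -> nat -> seq nat -> R) :
  chain m (fun r s => \sum_(i <- r0) F i r s) = \sum_(i <- r0) chain m (F i).
Proof.
elim: r0 => [|i r0 IH].
  by rewrite big_nil -[RHS](chain0 m); apply: eq_chain => r s; rewrite big_nil.
rewrite big_cons -IH -chainD; apply: eq_chain => r s; exact: big_cons.
Qed.

Lemma chainS m F : chain m (step F) = m.+1%:R * chain m.+1 F.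
Proof.
rewrite -[chain m.+1 F]/(chain m (fun r s => step F r s / m.+1%:R)) -chainZ.
apply: eq_chain => r s; by rewrite mulrC divfK // pnatr_eq0.
Qed.

Arguments chain : simpl never.

Lemma perm_rem (x : nat) s s' : perm_eq s s' -> perm_eq (rem x s) (rem x s').
Proof.
move=> ss'; have [xs|xs] := boolP (x \in s); last first.
  by rewrite !rem_id -?(perm_mem ss').
rewrite -(perm_cons x) -(permPl (perm_to_rem xs)) (permPl ss') perm_to_rem //.
by rewrite -(perm_mem ss').
Qed.

Lemma perm_rem_cat x (s s' : seq nat) a :
  x \in s -> perm_eq (rem x (a :: s ++ s')) (a :: rem x s ++ s').
Proof.
move=> xs; rewrite -(perm_cons x).
have /permPl <- : perm_eq (a :: s ++ s') (x :: rem x (a :: s ++ s')).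
  by apply: perm_to_rem; rewrite in_cons mem_cat xs orbT.
have /permPl -> : perm_eq (a :: s ++ s') (a :: (x :: rem x s) ++ s').
  by rewrite perm_cons perm_cat2r perm_to_rem.
by rewrite -cat1s (perm_catCA [:: a] [:: x]).
Qed.

Lemma perm_rem_catr x (s s' : seq nat) a :
  x \in s' -> perm_eq (rem x (a :: s ++ s')) (a :: s ++ rem x s').
Proof.
move=> xs; apply: (@perm_trans _ (rem x (a :: s' ++ s))).
  by apply: perm_rem; rewrite perm_cons perm_catC.
by rewrite (permPl (perm_rem_cat s a xs)) perm_cons perm_catC.
Qed.

Lemma symmetric_step F : symmetric_in_rest F -> symmetric_in_rest (step F).
Proof.
move=> Fsym r s s' ss'; rewrite /step; congr (_ + _).
  by apply: Fsym; rewrite perm_cons.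
rewrite (perm_big _ ss') /= !big_seq; apply: eq_bigr => x xs.
by apply: Fsym; rewrite !perm_cons perm_rem.
Qed.

(** The state obtained by an edge between the roots of two trees, the first
    root being that of the result. *)
Definition join F r s r' s' : R := F r.+1 (r'.+1 :: s ++ s').

(** A new node of a joined tree is attached in one of the two parts, hence the
    transition obeys a Leibniz rule. *)
Lemma step_join F r s r' s' : symmetric_in_rest F ->
  join (step F) r s r' s' =
  step (fun u v => join F u v r' s') r s + step (join F r s) r' s'.
Proof.
move=> Fsym; rewrite /join /step big_cons big_cat /= eqxx.
rewrite -addrA; congr (_ + _).
  by apply: Fsym; rewrite (perm_catCA [:: 1%N] [:: r'.+1]).
rewrite [RHS]addrCA; congr (_ + _).
  apply: Fsym; rewrite (perm_catCA [:: 1%N] [:: r'.+2]) /= perm_cons.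
  by rewrite -cat1s (perm_catCA [:: 1%N]).
congr (_ + _); rewrite !big_seq; apply: eq_bigr => x xs; apply: Fsym.
  apply: (@perm_trans _ ([:: 1; x.+1] ++ (r'.+1 :: rem x s ++ s')))%N.
    by rewrite /= !perm_cons; exact: (perm_rem_cat _ r'.+1 xs).
  by rewrite (perm_catCA [:: 1; x.+1]%N [:: r'.+1]).
apply: (@perm_trans _ ([:: 1; x.+1] ++ (r'.+1 :: s ++ rem x s')))%N.
  by rewrite /= !perm_cons; exact: (perm_rem_catr _ r'.+1 xs).
rewrite (perm_catCA [:: 1; x.+1]%N [:: r'.+1]) /= perm_cons.
by rewrite -[X in perm_eq _ X]/(s ++ [:: 1; x.+1] ++ rem x s')%N (perm_catCA [:: 1; x.+1]%N).
Qed.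

(** In a tree of size p + 2, cutting the edge between the nodes 1 and 2 leaves
    two independent recursive trees whose sizes i + 1 and p - i + 1 are
    uniform. Induction on p: by the Leibniz rule, a state of sizes (i + 1,
    p - i + 1) is reached from (i, p - i + 1) with weight i and from (i +
    1, p - i) with weight p - i, and these two weights have the same sum
    for all i. *)
Theorem chain_split p F : symmetric_in_rest F ->
  p.+1%:R * chain p.+1 F =
  \sum_(i < p.+1) chain i (fun r s => chain (p - i) (join F r s)).
Proof.
elim: p F => [|p IH] F Fsym.
  by rewrite big_ord1 mul1r /chain /step big_nil addr0 divr1 /join.
have -> : p.+2%:R * chain p.+2 F = chain p.+1 (step F) by rewrite chainS.
apply: (@mulfI _ p.+1%:R); first by rewrite pnatr_eq0.
rewrite (IH _ (symmetric_step Fsym)).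
pose a i q := chain i (fun r s => chain q (join F r s)).
have split_step (i : 'I_p.+1) :
    chain i (fun r s => chain (p - i) (join (step F) r s)) =
    i.+1%:R * a i.+1 (p.+1 - i.+1)%N + (p.+1 - i)%:R * a i (p.+1 - i)%N.
  have e1 : (p.+1 - i.+1 = p - i)%N by rewrite subSS.
  have e2 : (p.+1 - i = (p - i).+1)%N by rewrite subSn // -ltnS.
  rewrite e1 e2; set q := (p - i)%N.
  have -> : i.+1%:R * a i.+1 q = chain i (step (fun r s => chain q (join F r s))).
    by rewrite (chainS i).
  have -> : q.+1%:R * a i q.+1 = chain i (fun r s => chain q (step (join F r s))).
    by rewrite /a -(chainZ i); apply: eq_chain => r s; rewrite (chainS q).
  rewrite -chainD; apply: eq_chain => r s.
  transitivity (chain q (fun r' s' => step (fun u v => join F u v r' s') r s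
                                         + step (join F r s) r' s')).
    by apply: eq_chain => r' s'; exact: step_join.
  by rewrite chainD; congr (_ + _); rewrite {1}/step chainD chain_sum.
rewrite (eq_bigr _ (fun i _ => split_step i)) big_split /=.
rewrite -(big_mkord xpredT (fun i => i.+1%:R * a i.+1 (p.+1 - i.+1)%N)).
rewrite -(big_mkord xpredT (fun i => (p.+1 - i)%:R * a i (p.+1 - i)%N)).
have -> : \sum_(0 <= i < p.+1) i.+1%:R * a i.+1 (p.+1 - i.+1)%N =
          \sum_(0 <= i < p.+2) i%:R * a i (p.+1 - i)%N.
  by rewrite [RHS]big_nat_recl // mul0r add0r.
have -> : \sum_(0 <= i < p.+1) (p.+1 - i)%:R * a i (p.+1 - i)%N =
          \sum_(0 <= i < p.+2) (p.+1 - i)%:R * a i (p.+1 - i)%N.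
  by rewrite [RHS]big_nat_recr //= subnn mul0r addr0.
rewrite -big_split /= mulr_sumr big_mkord; apply: eq_bigr => i _.
have ip : (i <= p.+1)%N by rewrite -ltnS.
by rewrite -mulrDl -natrD (subnKC ip).
Qed.

End Chain.

(** * Splitting a recursive tree at its second node *)

Definition rest_degrees m (t : rrt m.+1) : seq nat :=
  [seq degree (rrt_adj t) (lift ord0 i) | i <- enum 'I_m].

Lemma root_degreeE m (t : rrt m.+1) : root_degree t = degree (rrt_adj t) ord0.
Proof. by rewrite /root_degree (big_pred1 ord0). Qed.

Lemma ZE k m (t : rrt m.+1) :
  Z k t = (root_degree t ^ k + \sum_(x <- rest_degrees t) x ^ k)%N.
Proof. by rewrite /Z /zagreb big_ord_recl root_degreeE big_map big_enum. Qed.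

Lemma root_degree_grow m (t : rrt m.+1) (a : 'I_m.+1) :
  root_degree (grow t a) = (root_degree t + (a == ord0))%N.
Proof.
rewrite !root_degreeE eq_sym -degree_grow; congr degree; exact: val_inj.
Qed.

Lemma rest_degrees_grow m (t : rrt m.+1) (a : 'I_m.+1) :
  rest_degrees (grow t a) =
  rcons [seq (degree (rrt_adj t) (lift ord0 i) + (lift ord0 i == a))%N | i <- enum 'I_m] 1%N.
Proof.
rewrite /rest_degrees enum_ordSr map_rcons -map_comp; congr rcons; last first.
  rewrite -(degree_grow_new t a); congr degree; exact: val_inj.
by apply: eq_map => i /=; rewrite -degree_grow; congr degree; exact: val_inj.
Qed.

Lemma perm_incr_at (I : eqType) (e : seq I) (f : I -> nat) (i : I) : uniq e -> i \in e ->
  perm_eq [seq (f j + (j == i))%N | j <- e] ((f i).+1 :: rem (f i) [seq f j | j <- e]).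
Proof.
move=> ue ie; have pe := perm_to_rem ie.
rewrite (permPl (perm_map _ pe)) /= eqxx addn1 perm_cons.
rewrite perm_sym (permPl (perm_rem (f i) (perm_map f pe))) /= eqxx.
have -> // : [seq f j | j <- rem i e] = [seq (f j + (j == i))%N | j <- rem i e].
by apply/eq_in_map => j; rewrite mem_rem_uniq // !inE => /andP[/negbTE -> _]; rewrite addn0.
Qed.

(** The chain computes means over uniform trees: attaching the new node at a
    node of degree x replaces one occurrence of x by x + 1 and adds one of
    1. *)
Lemma mean_state (R : realType) m (F : nat -> seq nat -> R) : symmetric_in_rest F ->
  unif_mean (fun t : rrt m.+1 => F (root_degree t) (rest_degrees t)) = chain m F.
Proof.
elim: m F => [|m IH] F Fsym.
  rewrite -[RHS](mean_cst (card_rrt_gt0 1)) /=; apply: eq_mean => t.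
  rewrite root_degreeE degreeE big_ord1 /rest_degrees enum_ord0 /=; congr F.
  by rewrite /rrt_adj orbb; case: is_parentP => // -[[]].
have Gsym : symmetric_in_rest (fun r s => step F r s / m.+1%:R).
  by move=> r s s' ss'; congr (_ / _); exact: symmetric_step.
rewrite mean_grow /= -(IH _ Gsym); apply: eq_mean => t; congr (_ / _).
rewrite big_ord_recl /step; congr (_ + _).
  rewrite root_degree_grow eqxx addn1; apply: Fsym.
  rewrite rest_degrees_grow perm_rcons perm_cons /rest_degrees (eq_map (g := fun i => degree (rrt_adj t) (lift ord0 i))) //.
  by move=> i; rewrite addn0.
rewrite [in RHS]/rest_degrees big_map big_enum /=; apply: eq_bigr => i _.
rewrite root_degree_grow addn0; apply: Fsym; rewrite rest_degrees_grow perm_rcons perm_cons.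
have -> : [seq (degree (rrt_adj t) (lift ord0 i0) + (lift ord0 i0 == lift ord0 i))%N | i0 <- enum 'I_m]
  = [seq (degree (rrt_adj t) (lift ord0 i0) + (i0 == i))%N | i0 <- enum 'I_m].
  by apply: eq_map => j; rewrite (inj_eq lift_inj).
exact: (perm_incr_at (fun j => degree (rrt_adj t) (lift ord0 j)) (enum_uniq 'I_m) (mem_enum _ i)).
Qed.

Section Split.
Variables (R : realType) (k : nat).

(** Increase of the index when one more edge is attached at a node of degree
    x. *)
Definition attach_gain (x : nat) : nat := ((x.+1) ^ k - x ^ k)%N.

(** Each root gets one more edge from the cut edge, which explains the two
    gains added to the indices of the parts. *)
Lemma mean_split (Phi : nat -> R) p :
  unif_mean (fun t : rrt p.+2 => Phi (Z k t)) =
  (\sum_(1 <= j < p.+2) unif_mean (fun ts : rrt j * rrt (p.+2 - j) =>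
     Phi (Z k ts.1 + Z k ts.2 + (attach_gain (root_degree ts.1) + attach_gain (root_degree ts.2)))%N))
  / p.+1%:R.
Proof.
pose zk r (s : seq nat) := (r ^ k + \sum_(x <- s) x ^ k)%N.
pose F r s := Phi (zk r s).
have Fsym : symmetric_in_rest F.
  by move=> r s s' ss'; rewrite /F /zk (perm_big _ ss').
transitivity (unif_mean (fun t : rrt p.+2 => F (root_degree t) (rest_degrees t))).
  by apply: eq_mean => t; rewrite /F /zk -ZE.
rewrite (mean_state _ Fsym); apply: (canRL (mulfK _)); first by rewrite pnatr_eq0.
rewrite mulrC chain_split // big_add1 /= big_mkord; apply: eq_bigr => i _.
have e : (p.+2 - i.+1 = (p - i).+1)%N by rewrite subSS subSn // -ltnS.
rewrite mean_prod e.
have joinE r s r' s' : join F r s r' s' =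
    Phi (zk r s + zk r' s' + (attach_gain r + attach_gain r'))%N.
  rewrite /join /F; congr Phi; rewrite /zk big_cons big_cat /= /attach_gain.
  have h x : (x ^ k <= x.+1 ^ k)%N by case: k => // k'; rewrite leq_exp2r.
  have := h r; have := h r'; lia.
pose Gr r s := chain (p - i) (join F r s).
have Gsym : symmetric_in_rest Gr.
  move=> r s s' ss'; apply: eq_chain => u v; rewrite !joinE; congr Phi.
  by rewrite /zk (perm_big _ ss').
rewrite -[LHS](mean_state _ Gsym); apply: eq_mean => t; rewrite /Gr -mean_state.
  by apply: eq_mean => t'; rewrite joinE /zk -!ZE.
by move=> r s s' ss'; rewrite !joinE /zk (perm_big _ ss').
Qed.

End Split.

(** * Root moments and a lower bound for the variance *)

Lemma mean_growE (R : realType) m (H : rrt m.+2 -> R) :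
  unif_mean H = unif_mean (fun t : rrt m.+1 => unif_mean (fun a => H (grow t a))).
Proof. by rewrite mean_grow; apply: eq_mean => t; rewrite /unif_mean card_ord. Qed.

Section RootMoments.
Variable R : realType.

Lemma binomial_succ (x : R) m : (x + 1) ^+ m = \sum_(l < m.+1) 'C(m, l)%:R * x ^+ l.
Proof.
rewrite addrC exprDn; apply: eq_bigr => i _.
by rewrite expr1n mul1r mulr_natl.
Qed.

(** The new node is attached at the root with probability 1 / (n + 1), and the
    binomial formula expands the effect on a power. *)
Lemma root_moment_rec m n :
  unif_mean (fun t : rrt n.+2 => (root_degree t)%:R ^+ m : R) =
  unif_mean (fun t : rrt n.+1 => (root_degree t)%:R ^+ m) +
  (\sum_(l < m) 'C(m, l)%:R * unif_mean (fun t : rrt n.+1 => (root_degree t)%:R ^+ l)) / n.+1%:R.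
Proof.
rewrite mean_grow.
transitivity (unif_mean (fun t : rrt n.+1 => (root_degree t)%:R ^+ m +
   (\sum_(l < m) 'C(m, l)%:R * (root_degree t)%:R ^+ l) / n.+1%:R : R)).
  apply: eq_mean => t; rewrite big_ord_recl root_degree_grow eqxx.
  rewrite (eq_bigr (fun _ => (root_degree t)%:R ^+ m)); last first.
    by move=> i _; rewrite root_degree_grow addn0.
  rewrite sumr_const card_ord natrD binomial_succ big_ord_recr /= binn mul1r.
  rewrite -[X in _ + X]mulr_natl -natr1; field.
  by rewrite natr1 pnatr_eq0.
rewrite meanD meanZr mean_sum; congr (_ + _ / _).
by apply: eq_bigr => l _; rewrite meanZ.
Qed.

(** Discrete counterpart of the derivative of the square root, used to sum
    increments of order 1 / sqrt n. *)
Lemma sqrt_succ n : (Num.sqrt n.+1%:R)^-1 <= 3 * (Num.sqrt n.+2%:R - Num.sqrt n.+1%:R) :> R.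
Proof.
set x := Num.sqrt n.+1%:R; set y := Num.sqrt n.+2%:R.
have x1 : 1 <= x by rewrite -sqrtr1 ler_sqrt ?ler1n ?ltr0n.
have y0 : 0 <= y by exact: sqrtr_ge0.
have xx : x ^+ 2 = n.+1%:R by rewrite sqr_sqrtr.
have yy : y ^+ 2 = x ^+ 2 + 1 by rewrite sqr_sqrtr // xx natr1.
have yx : y <= 2 * x by rewrite -(ler_pXn2r (n := 2)) ?nnegrE //; [nra|lra].
have x0 : 0 < x by lra.
rewrite -(ler_pM2l x0) mulfV ?gt_eqF //.
have xy : x <= y by rewrite -(ler_pXn2r (n := 2)) ?nnegrE // ?yy ?lerDl //; lra.
have : (y - x) * (y + x) = 1 by move: yy; rewrite !expr2; lra.
nra.
Qed.

(** By induction on m, using root_moment_rec: the increments are O(sqrt n / n), whose sum is O(sqrt n). *)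
Lemma root_moment m : exists2 C : R, 0 <= C &
  forall n, unif_mean (fun t : rrt n.+1 => (root_degree t)%:R ^+ m) <= C * Num.sqrt n.+1%:R.
Proof.
elim/ltn_ind: m => m IH.
have [C C0 HC] : exists2 C : nat -> R, (forall l, 0 <= C l) & forall l n, (l < m)%N ->
    unif_mean (fun t : rrt n.+1 => (root_degree t)%:R ^+ l) <= C l * Num.sqrt n.+1%:R.
  have /choice [C HC] : forall l, exists c : R, 0 <= c /\ forall n, (l < m)%N ->
      unif_mean (fun t : rrt n.+1 => (root_degree t)%:R ^+ l) <= c * Num.sqrt n.+1%:R.
    move=> l; have [lm|lm] := ltnP l m; last by exists 0.
    by have [c c0 hc] := IH l lm; exists c.
  by exists C => [l|l n lm]; have [] := HC l => // _; apply.
pose D := \sum_(l < m) 'C(m, l)%:R * C l.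
have D0 : 0 <= D by apply: sumr_ge0 => l _; rewrite mulr_ge0.
exists (1 + 3 * D); first by lra.
elim=> [|n IHn].
  rewrite sqrtr1 mulr1.
  apply: (@le_trans _ _ 1); last by lra.
  rewrite -[leRHS](mean_cst (card_rrt_gt0 1)); apply: ler_mean => t.
  rewrite root_degreeE degreeE big_ord1 {1}/rrt_adj orbb; case: is_parentP => [[[]]//|_].
  by rewrite expr0n; case: (m == 0%N).
rewrite root_moment_rec.
set s1 := Num.sqrt n.+1%:R in IHn *; set s2 := Num.sqrt n.+2%:R.
have s10 : 0 < s1 by rewrite sqrtr_gt0 ltr0n.
have h : (\sum_(l < m) 'C(m, l)%:R *
     unif_mean (fun t : rrt n.+1 => (root_degree t)%:R ^+ l)) / n.+1%:R <= D * s1^-1.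
  have -> : D * s1^-1 = (D * s1) / n.+1%:R.
    by rewrite -(sqr_sqrtr (ler0n R n.+1)) -/s1; field; rewrite gt_eqF.
  rewrite ler_wpM2r ?invr_ge0 // mulr_suml; apply: ler_sum => l _.
  by rewrite -mulrA ler_wpM2l // HC.
have := sqrt_succ n; rewrite -/s1 -/s2 => h2.
apply: (le_trans (lerD IHn h)).
have : D * s1^-1 <= D * (3 * (s2 - s1)) by rewrite ler_wpM2l.
have : s1 <= s2 by rewrite ler_sqrt ?ltr0n // ler_nat.
nra.
Qed.

Lemma attach_gain_binomial k x : (attach_gain k x)%:R = \sum_(0 <= l < k) 'C(k, l)%:R * x%:R ^+ l :> R.
Proof.
rewrite /attach_gain natrB; last by case: k => // k'; rewrite leq_exp2r.
rewrite !natrX -natr1 binomial_succ big_ord_recr /= binn mul1r addrK.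
by rewrite big_mkord.
Qed.

Lemma attach_gain_moment4 k : exists2 C : R, 0 <= C &
  forall n, unif_mean (fun t : rrt n.+1 => (attach_gain k (root_degree t))%:R ^+ 4) <= C * n.+1%:R.
Proof.
have /choice [C HC] : forall l, exists c : R, 0 <= c /\ forall n,
    unif_mean (fun t : rrt n.+1 => (root_degree t)%:R ^+ l) <= c * Num.sqrt n.+1%:R.
  by move=> l; have [c c0 hc] := root_moment l; exists c.
exists (\sum_(l < (k * 4).+1) 'C(k * 4, l)%:R * C l).
  by apply: sumr_ge0 => l _; rewrite mulr_ge0 //; have [] := HC l.
move=> n.
apply: (@le_trans _ _ (unif_mean (fun t : rrt n.+1 => ((root_degree t)%:R + 1) ^+ (k * 4)))).
  apply: ler_mean => t; rewrite exprM lerXn2r ?nnegrE ?exprn_ge0 ?addr_ge0 //.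
  by rewrite natr1 -natrX ler_nat leq_subr.
rewrite (eq_mean (fun t => binomial_succ _ _)) mean_sum mulr_suml; apply: ler_sum => l _.
rewrite meanZ -mulrA ler_wpM2l //; have [c0 hc] := HC l; apply: (le_trans (hc n)).
rewrite ler_wpM2l // -[leRHS]sqr_sqrtr // expr2 ler_peMl ?sqrtr_ge0 //.
by rewrite -[X in X <= _]sqrtr1 ler_sqrt ?ltr0n // ler1n.
Qed.

End RootMoments.

Section VarianceLowerBound.
Variable R : realType.

Definition variance (T : finType) (f : T -> R) : R :=
  unif_mean (fun t => (f t - unif_mean f) ^+ 2).

Lemma varianceE (T : finType) (f : T -> R) : (0 < #|T|)%N ->
  variance f = unif_mean (fun t => f t ^+ 2) - unif_mean f ^+ 2.
Proof.
move=> T0; rewrite /variance; set c := unif_mean f.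
rewrite (eq_mean (g := fun t => f t ^+ 2 - (2 * c) * f t + c ^+ 2)); last by move=> t; ring.
by rewrite meanD meanB meanZ mean_cst // -/c; ring.
Qed.

Lemma variance_ge0 (T : finType) (f : T -> R) : 0 <= variance f.
Proof. by apply: mean_ge0 => t; exact: sqr_ge0. Qed.

(** Two variances can thus be compared through the differences of values,
    without their means. *)
Lemma variance_pairs (T : finType) (f : T -> R) : (0 < #|T|)%N ->
  unif_mean (fun a => unif_mean (fun b => (f a - f b) ^+ 2)) = 2 * variance f.
Proof.
move=> T0; rewrite varianceE //; set m := unif_mean f; set q := unif_mean (fun t => f t ^+ 2).
rewrite (eq_mean (g := fun a => f a ^+ 2 - (2 * m) * f a + q)).
  by rewrite meanD meanB meanZ mean_cst // -/m -/q; ring.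
move=> a; rewrite (eq_mean (g := fun b => f a ^+ 2 - (2 * f a) * f b + f b ^+ 2)).
  by rewrite meanD meanB meanZ mean_cst // -/m -/q; ring.
by move=> b; ring.
Qed.

Lemma ler_variance (T : finType) (f g : T -> R) : (0 < #|T|)%N ->
  (forall a b, `|f a - f b| <= `|g a - g b|) -> variance f <= variance g.
Proof.
move=> T0 fg; rewrite -(ler_pM2l (ltr0Sn R 1)) -!variance_pairs //.
apply: ler_mean => a; apply: ler_mean => b.
by rewrite -(real_normK (num_real (f a - f b))) -(real_normK (num_real (g a - g b))) lerXn2r ?nnegrE.
Qed.

Definition degree_sum (g : nat -> R) n (t : rrt n) : R :=
  \sum_(v : 'I_n) g (degree (rrt_adj t) v).

Definition slope (g : nat -> R) (x : nat) : R := g x.+1 - g x.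

(** Second differences at least 1; this class is stable under the conditional
    expectation of a growth step. *)
Definition strictly_convex (g : nat -> R) := forall x, 1 <= slope (slope g) x.

Lemma degree_sum_grow g m (t : rrt m.+1) (a : 'I_m.+1) :
  degree_sum g (grow t a) = degree_sum g t + slope g (degree (rrt_adj t) a) + g 1%N.
Proof.
rewrite /degree_sum big_ord_recr /= degree_grow_new; congr (_ + _).
rewrite (bigD1 a) //= [in RHS](bigD1 a) //= degree_grow eqxx addn1 /slope.
rewrite (eq_bigr (fun v => g (degree (rrt_adj t) v))); first by ring.
by move=> v va; rewrite degree_grow (negbTE va) addn0.
Qed.

(** Weight of the degree sum that is the conditional expectation after one
    growth step (degree_sum_grown_weight); the value g 1 of the new node is shared equally among the old nodes. *)
Definition grown_weight m (g : nat -> R) x : R := g x + (slope g x + g 1%N) / m.+1%:R.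

Lemma degree_sum_grown_weight g m (t : rrt m.+1) :
  degree_sum (grown_weight m g) t = unif_mean (fun a => degree_sum g (grow t a)).
Proof.
rewrite (eq_mean (degree_sum_grow g t)) meanD meanD !mean_cst ?card_ord //.
rewrite /degree_sum /grown_weight big_split /= -mulr_suml big_split /= sumr_const card_ord mulrDl.
rewrite -(mulr_natr (g 1%N)) mulfK ?pnatr_eq0 //.
by rewrite /unif_mean card_ord addrA.
Qed.

(** The new second difference at x is the convex combination of those at x and
    x + 1 with weights 1 - 1/(m+1) and 1/(m+1). *)
Lemma strictly_convex_grown_weight m g : strictly_convex g -> strictly_convex (grown_weight m g).
Proof.
move=> gc x; have := gc x; have := gc x.+1; rewrite /grown_weight /slope => h2 h1.
set n := m.+1%:R; have n1 : 1 <= n :> R by rewrite ler1n.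
have n0 : 0 < n by lra.
set p := g x in h1 h2 *; set q := g x.+1 in h1 h2 *; set r := g x.+2 in h1 h2 *.
set u := g x.+3 in h1 h2 *; set c := g 1%N.
have -> : r + (u - r + c) / n - (q + (r - q + c) / n) - (q + (r - q + c) / n - (p + (q - p + c) / n))
  = (r - q - (q - p)) * (1 - n^-1) + (u - r - (r - q)) * n^-1 by field; rewrite gt_eqF.
have i0 : 0 < n^-1 by rewrite invr_gt0.
have i1 : n^-1 <= 1 by rewrite invf_le1.
move: (r - q - (q - p)) (u - r - (r - q)) n^-1 h1 h2 i0 i1 => A B i h1 h2 i0 i1.
nra.
Qed.

Lemma slope_lipschitz g : strictly_convex g -> forall x y : nat,
  `|x%:R - y%:R| <= `|slope g x - slope g y|.
Proof.
move=> gc x y; wlog xy : x y / (x <= y)%N.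
  by move=> H; have [/H//|/ltnW/H] := leqP x y; rewrite distrC [leRHS]distrC.
have h d : d%:R <= slope g (x + d)%N - slope g x.
  elim: d => [|d IH]; first by rewrite addn0 subrr.
  by have := gc (x + d)%N; rewrite {1}/slope addnS -natr1; lra.
rewrite distrC [leRHS]distrC -(subnKC xy) natrD [x%:R + _]addrC addrK.
by rewrite !ger0_norm //; apply: le_trans (h _).
Qed.

Lemma sum_degrees m (t : rrt m.+1) : degree_sum (fun x => x%:R) t = 2 * m%:R.
Proof.
elim: m t => [|m IH] t.
  rewrite /degree_sum big_ord1 degreeE big_ord1 {1}/rrt_adj orbb mulr0.
  by case: is_parentP => [[[]]//|_].
have [h _ hK] := grow_bij m; rewrite -(hK t) degree_sum_grow IH /slope -!natr1; ring.
Qed.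

(** The mean of the sum of squared degrees increases by 6 - 4/(m+1) at each
    step, so that it is close to 6 m. The lower bound with slope 5 is
    enough to beat the squared mean degree, about 4. *)
Lemma second_moment_degrees m :
  5 * m%:R - 5 <= unif_mean (fun t : rrt m.+1 => degree_sum (fun x => x%:R ^+ 2) t).
Proof.
pose e m := unif_mean (fun t : rrt m.+1 => degree_sum (fun x => x%:R ^+ 2) t).
have rec n : e n.+1 = e n + 6 - 4 / n.+1%:R.
  rewrite /e mean_growE.
  transitivity (unif_mean (fun t : rrt n.+1 => degree_sum (fun x => x%:R ^+ 2) t + (6 - 4 / n.+1%:R) : R)).
    apply: eq_mean => t; rewrite (eq_mean (degree_sum_grow _ t)) meanD meanD !mean_cst ?card_ord //.
    rewrite expr1n /unif_mean card_ord /slope.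
    rewrite (eq_bigr (fun a => 2 * (degree (rrt_adj t) a)%:R + 1)); last first.
      by move=> a _; rewrite -natr1; ring.
    rewrite big_split /= -mulr_sumr -/(degree_sum (fun x => x%:R) t) sum_degrees sumr_const card_ord -(natr1 n).
    by field; rewrite natr1 pnatr_eq0.
  by rewrite meanD mean_cst ?card_rrt_gt0 // addrA.
have e0 : e 0%N = 0.
  rewrite /e -[RHS](mean_cst (card_rrt_gt0 1)); apply: eq_mean => t.
  rewrite /degree_sum big_ord1 degreeE big_ord1 {1}/rrt_adj orbb.
  by case: is_parentP => [[[]]//|_]; rewrite expr0n.
have e1 : e 1%N = 2 by rewrite rec e0; field.
have e2 : e 2%N = 6 by rewrite rec e1; field.
have e3 : e 3 = 32 / 3 by rewrite rec e2; field.
rewrite -/(e m); have [m3|m3] := ltnP m 3.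
  by case: m m3 => [|[|[|]]] // _; rewrite ?e0 ?e1 ?e2; lra.
rewrite -(subnKC m3); elim: (m - 3)%N => [|d IH]; first by rewrite addn0 e3; lra.
rewrite addnS rec.
have : 4 / (3 + d).+1%:R <= 1 :> R by rewrite ler_pdivrMr ?ltr0n // mul1r ler_nat.
rewrite -(natr1 (3 + d)); lra.
Qed.

(** Lower bound of linear order for the variance of a degree sum. One growth
    step splits the variance into that of the conditional expectation,
    again a degree sum with a convex weight, and the mean variance of the
    slope of g at a uniform node. As slopes of g differ at least as much
    as degrees, the latter is at least the variance of the degree of a
    uniform node, whose limit is 6 - 4 = 2. *)
Lemma variance_degree_sum m g : strictly_convex g ->
  (m%:R - 5) / 2 <= variance (fun t : rrt m.+1 => degree_sum g t).
Proof.
elim: m g => [|m IH] g gc.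
  by apply: le_trans (variance_ge0 _); lra.
have mvar : variance (fun t : rrt m.+2 => degree_sum g t) =
    variance (fun t : rrt m.+1 => degree_sum (grown_weight m g) t)
    + unif_mean (fun t : rrt m.+1 => variance (fun a => slope g (degree (rrt_adj t) a))).
  rewrite {1}/variance; set c := unif_mean (fun t : rrt m.+2 => degree_sum g t).
  have cE : c = unif_mean (fun t : rrt m.+1 => degree_sum (grown_weight m g) t).
    by rewrite /c mean_growE; apply: eq_mean => t; rewrite (degree_sum_grown_weight g t).
  rewrite {1}/variance -cE -meanD mean_growE; apply: eq_mean => t.
  have I0 : (0 < #|'I_m.+1|)%N by rewrite card_ord.
  set s := unif_mean (fun a => slope g (degree (rrt_adj t) a)).
  have -> : degree_sum (grown_weight m g) t = degree_sum g t + s + g 1%N.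
    by rewrite degree_sum_grown_weight (eq_mean (degree_sum_grow _ t)) meanD meanD !mean_cst.
  rewrite varianceE // -/s; set d := degree_sum g t.
  rewrite (eq_mean (g := fun a => (d + g 1%N - c) ^+ 2
      + 2 * (d + g 1%N - c) * slope g (degree (rrt_adj t) a)
      + slope g (degree (rrt_adj t) a) ^+ 2)); last first.
    by move=> a; rewrite degree_sum_grow -/d; ring.
  by rewrite !meanD meanZ mean_cst // -/s; ring.
rewrite mvar; have [m5|m5] := leqP m 4.
  apply: (@le_trans _ _ 0); last first.
    by rewrite addr_ge0 ?variance_ge0 //; apply: mean_ge0 => t; exact: variance_ge0.
  have : m.+1%:R <= 5 :> R by rewrite ler_nat.
  lra.
have := IH _ (strictly_convex_grown_weight m gc).
suff : 2^-1 <= unif_mean (fun t : rrt m.+1 => variance (fun a => slope g (degree (rrt_adj t) a))).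
  by rewrite -(natr1 m); lra.
apply: (@le_trans _ _ (unif_mean (fun t : rrt m.+1 => variance (fun a => (degree (rrt_adj t) a)%:R)))); last first.
  apply: ler_mean => t; apply: ler_variance; first by rewrite card_ord.
  by move=> a b; exact: slope_lipschitz.
pose n : R := m.+1%:R; have n1 : 6 <= n by rewrite ler_nat.
have mn : m%:R = n - 1 :> R by rewrite /n -natr1 addrK.
rewrite (eq_mean (g := fun t : rrt m.+1 => degree_sum (fun x => x%:R ^+ 2) t / n - (2 * (n - 1) / n) ^+ 2)).
  rewrite meanB meanZr mean_cst ?card_rrt_gt0 //.
  apply: (@le_trans _ _ ((5 * m%:R - 5) / n - (2 * (n - 1) / n) ^+ 2)); last first.
    by rewrite lerD2r ler_wpM2r ?second_moment_degrees // invr_ge0; lra.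
  rewrite mn -subr_ge0.
  have -> : (5 * (n - 1) - 5) / n - (2 * (n - 1) / n) ^+ 2 - 2^-1 =
            (n ^+ 2 / 2 - 2 * n - 4) / n ^+ 2 by field; lra.
  by rewrite divr_ge0 ?sqr_ge0 //; nra.
move=> t; rewrite varianceE ?card_ord //; congr (_ - _ ^+ 2).
  by rewrite /unif_mean card_ord.
by rewrite -mn -(sum_degrees t) /unif_mean card_ord.
Qed.

Lemma strictly_convex_pow k : (2 <= k)%N -> strictly_convex (fun x => x%:R ^+ k).
Proof.
move=> k2 x; rewrite /slope -(subnKC k2); elim: (k - 2)%N => [|d IH].
  by rewrite addn0 -(natr1 x.+1) -(natr1 x); nra.
have E (u : R) : u ^+ (2 + d.+1) = u * u ^+ (2 + d) by rewrite addnS exprS.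
move: IH; rewrite !E -(natr1 x.+1) -(natr1 x).
have x0 : 0 <= x%:R :> R by [].
have : x%:R ^+ (2 + d) <= (x%:R + 1) ^+ (2 + d) :> R.
  by rewrite lerXn2r ?nnegrE ?lerDl //; lra.
set A := (_ + 1) ^+ _; set B := (_ + 1 + 1) ^+ _; set C := _ ^+ _; set y := x%:R in x0 *.
nra.
Qed.

(** Non-degeneracy of the limit: the power is strictly convex because k >= 2. *)
Theorem variance_Z_lower k m : (2 <= k)%N ->
  (m%:R - 5) / 2 <= variance (fun t : rrt m.+1 => (Z k t)%:R).
Proof.
move=> k2; have := variance_degree_sum m (strictly_convex_pow k2).
congr (_ <= variance _); apply/funext => t.
by rewrite /degree_sum /Z /zagreb natr_sum; apply: eq_bigr => v _; rewrite natrX.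
Qed.

End VarianceLowerBound.

(** * The recurrence of the split and its solution *)

Section Sequences.
Variable R : realType.

(** All error terms are measured in powers of the fourth root of n. *)
Definition quarter (n : nat) : R := Num.sqrt (Num.sqrt n%:R).

Lemma quarter_ge0 n : 0 <= quarter n.
Proof. exact: sqrtr_ge0. Qed.

Lemma quarter_gt0 n : (0 < n)%N -> 0 < quarter n.
Proof. by move=> n0; rewrite !sqrtr_gt0 ltr0n. Qed.

Lemma quarter2 n : quarter n ^+ 2 = Num.sqrt n%:R.
Proof. by rewrite sqr_sqrtr ?sqrtr_ge0. Qed.

Lemma quarter4 n : quarter n ^+ 4 = n%:R.
Proof. by rewrite (exprM _ 2 2) quarter2 sqr_sqrtr. Qed.

Lemma ler_quarter m n : (m <= n)%N -> quarter m <= quarter n.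
Proof. by move=> mn; rewrite !ler_wsqrtr // ler_nat. Qed.

Lemma quarter_ge1 n : (0 < n)%N -> 1 <= quarter n.
Proof. by move=> n0; have := ler_quarter n0; rewrite /quarter !sqrtr1. Qed.

Lemma cvg_inv_quarter : (quarter n)^-1 @[n --> \oo] --> (0 : R).
Proof.
have h : n%:R^-1 @[n --> \oo] --> (0 : R).
  apply/gtr0_cvgV0; last exact: cvgr_idn.
  by near=> n; rewrite ltr0n; near: n; exact: nbhs_infty_gt.
rewrite (_ : (fun n => _) = (fun n => Num.sqrt (Num.sqrt (n%:R^-1)))); last first.
  by apply/funext => n; rewrite /quarter !sqrtrV ?sqrtr_ge0.
have -> : 0 = Num.sqrt (Num.sqrt 0) :> R by rewrite !sqrtr0.
apply: continuous_cvg; first exact: sqrt_continuous.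
by apply: continuous_cvg; first exact: sqrt_continuous.
Unshelve. all: by end_near. Qed.

Lemma cvg_dist_le (u e : nat -> R) l N :
  (forall n, (N <= n)%N -> `|u n - l| <= e n) -> e @ \oo --> 0 -> u @ \oo --> l.
Proof.
move=> ue e0; apply/cvgrPdist_le => eps eps0.
near=> n; rewrite distrC; apply: (le_trans (ue n _)).
  by near: n; exact: nbhs_infty_ge.
by near: n; exact: (cvgr_le _ e0).
Unshelve. all: by end_near. Qed.

(** The weights 1/(j(j+1)) are those of the solution of the recurrence of the
    split, given in split_recurrence. *)
Definition weighted_sum (c : nat -> R) (m n : nat) : R := \sum_(m <= j < n) c j / (j * j.+1)%:R.

Lemma weighted_sum_recr c m n : (m <= n)%N -> weighted_sum c m n.+1 = weighted_sum c m n + c n / (n * n.+1)%:R.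
Proof. by move=> mn; rewrite /weighted_sum big_nat_recr. Qed.

Lemma weighted_sum_cat c m n p : (m <= n)%N -> (n <= p)%N -> weighted_sum c m p = weighted_sum c m n + weighted_sum c n p.
Proof. by move=> mn np; rewrite /weighted_sum (big_cat_nat mn np). Qed.

(** Multiplying by n - 1 and subtracting consecutive equations telescopes the
    recurrence: the sum of a_1, ..., a_(n-1) is n (n - 1) times the
    weighted sum of c up to n - 1. *)
Lemma split_recurrence (a c : nat -> R) : a 1%N = 0 ->
  (forall n, (2 <= n)%N -> a n = 2 / n.-1%:R * \sum_(1 <= j < n) a j + c n) ->
  forall n, (2 <= n)%N -> a n = c n + 2 * n%:R * weighted_sum c 2 n.
Proof.
move=> a1 rec.
have Sa n : \sum_(1 <= j < n.+2) a j = n.+1%:R * n.+2%:R * weighted_sum c 2 n.+2.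
  elim: n => [|n IH]; first by rewrite big_nat1 a1 /weighted_sum big_geq // mulr0.
  rewrite big_nat_recr // IH rec //= IH (@weighted_sum_recr c 2 n.+2) // natrM -!natr1.
  set w := weighted_sum _ _ _; have n0 : 0 <= n%:R :> R by [].
  by field; rewrite !lt0r_neq0 //; lra.
case=> [|[|n]] // _; rewrite rec // Sa /=.
have n0 : n.+1%:R != 0 :> R by rewrite pnatr_eq0.
by rewrite addrC; congr (_ + _); field.
Qed.

(** With u and w the fourth roots of j and j + 1, one has w^4 - u^4 = 1, hence
    1/u - 1/w = 1/(u w (w + u)(w^2 + u^2)) >= 1/(4 u w^4). *)
Lemma quarter_telescope j : (0 < j)%N ->
  quarter j ^+ 3 / (j * j.+1)%:R <= 4 * ((quarter j)^-1 - (quarter j.+1)^-1).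
Proof.
move=> j0; rewrite natrM -(quarter4 j) -(quarter4 j.+1).
have : quarter j.+1 ^+ 4 = quarter j ^+ 4 + 1 by rewrite !quarter4 natr1.
have := ler_quarter (leqnSn j); have := quarter_gt0 j0.
set u := quarter j; set w := quarter j.+1 => u0 uw uw4.
have w0 : 0 < w by lra.
rewrite -subr_ge0.
have -> : 4 * (u^-1 - w^-1) - u ^+ 3 / (u ^+ 4 * w ^+ 4) = (4 * w ^+ 3 * (w - u) - 1) / (u * w ^+ 4).
  by field; rewrite !gt_eqF.
rewrite divr_ge0 ?mulr_ge0 ?exprn_ge0 ?(ltW u0) ?(ltW w0) //.
have -> : 4 * w ^+ 3 * (w - u) - 1 = (w - u) * (4 * w ^+ 3 - (w ^+ 3 + w ^+ 2 * u + w * u ^+ 2 + u ^+ 3)).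
  have E : w ^+ 4 - u ^+ 4 = 1 by rewrite uw4 addrAC subrr add0r.
  by rewrite -[X in _ - X = _]E; ring.
rewrite mulr_ge0 ?subr_ge0 //.
have u0' := ltW u0; have w0' := ltW w0.
have h1 : w ^+ 2 * u <= w ^+ 3 by rewrite [leRHS]exprSr ler_wpM2l ?sqr_ge0.
have h2 : w * u ^+ 2 <= w ^+ 3 by rewrite [leRHS]exprS ler_wpM2l // lerXn2r ?nnegrE.
have h3 : u ^+ 3 <= w ^+ 3 by rewrite lerXn2r ?nnegrE.
lra.
Qed.

Lemma weighted_sum_quarter_le m n : (0 < m)%N ->
  weighted_sum (fun j => quarter j ^+ 3) m n <= 4 / quarter m.
Proof.
move=> m0; have [nm|mn] := leqP n m.
  by rewrite /weighted_sum big_geq // divr_ge0 // quarter_ge0.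
apply: (@le_trans _ _ (4 * ((quarter m)^-1 - (quarter n)^-1))); last first.
  by rewrite ler_wpM2l // gerBl invr_ge0 quarter_ge0.
rewrite /weighted_sum -(subnKC (ltnW mn)); elim: (n - m)%N => [|d IH].
  by rewrite addn0 big_geq // subrr mulr0.
rewrite addnS big_nat_recr ?leq_addr //=.
apply: (le_trans (lerD IH (quarter_telescope (ltn_addr d m0)))); lra.
Qed.

Lemma weighted_sum_tail c C m n : (0 < m)%N -> 0 <= C ->
  (forall j, (m <= j < n)%N -> `|c j| <= C * quarter j ^+ 3) ->
  `|weighted_sum c m n| <= 4 * C / quarter m.
Proof.
move=> m0 C0 cC; apply: (@le_trans _ _ (C * weighted_sum (fun j => quarter j ^+ 3) m n)).
  apply: (le_trans (ler_norm_sum _ _ _)); rewrite /weighted_sum mulr_sumr.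
  apply: ler_sum_nat => j mj; rewrite normrM [`|_^-1|]ger0_norm ?invr_ge0 //.
  by rewrite mulrA ler_wpM2r ?invr_ge0 // cC.
by rewrite [4 * C]mulrC -mulrA ler_wpM2l // weighted_sum_quarter_le.
Qed.

(** A Cauchy criterion which keeps the rate. *)
Lemma cvg_tail (S : nat -> R) (e : nat -> R) N :
  (forall m n, (N <= m <= n)%N -> `|S n - S m| <= e m) -> e @ \oo --> 0 ->
  exists2 L, S @ \oo --> L & forall m, (N <= m)%N -> `|S m - L| <= e m.
Proof.
move=> Se e0; have cS : cvg (S @ \oo).
  apply/cauchy_cvgP/cauchy_exP => eps eps0.
  have [m [Nm em]] : exists m, (N <= m)%N /\ e m < eps.
    near \oo => m; exists m; split; first by near: m; exact: nbhs_infty_ge.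
    by near: m; apply: (cvgr_lt _ e0).
  exists (S m); change (\forall n \near \oo, ball (S m) eps (S n)); near=> n.
  rewrite /ball /= distrC; apply: le_lt_trans em; apply: Se.
  by rewrite Nm; near: n; exact: nbhs_infty_ge.
exists (lim (S @ \oo)) => // m Nm.
have h : `|S m - S n| @[n --> \oo] --> `|S m - lim (S @ \oo)|.
  by apply: cvg_norm; apply: cvgB => //; exact: cvg_cst.
apply: (cvgr_to_le h); near=> n; rewrite distrC; apply: Se; rewrite Nm.
by near: n; exact: nbhs_infty_ge.
Unshelve. all: by end_near. Qed.

Lemma cvg_weighted_sum c C : 0 <= C -> (forall j, (2 <= j)%N -> `|c j| <= C * quarter j ^+ 3) ->
  exists L, (weighted_sum c 2 @ \oo --> L) /\ forall m, (2 <= m)%N -> `|weighted_sum c 2 m - L| <= 4 * C / quarter m.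
Proof.
move=> C0 cC; pose e m : R := 4 * C / quarter m.
have e0 : e @ \oo --> 0.
  by rewrite -[0](mulr0 (4 * C)); apply: cvgMr; exact: cvg_inv_quarter.
have [|L SL HL] := @cvg_tail (weighted_sum c 2) e 2 _ e0; last by exists L.
move=> m n /andP[m2 mn]; rewrite (weighted_sum_cat c m2 mn) addrC addKr; apply: weighted_sum_tail => //.
- exact: ltn_trans m2.
- by move=> j /andP[mj _]; apply: cC; exact: leq_trans mj.
Qed.

(** The faster rate is needed to replace the mean by its
    linear equivalent with an error o(sqrt n). *)
Lemma cvg_weighted_sum_rate c C : 0 <= C -> (forall j, (2 <= j)%N -> `|c j| <= C * quarter j) ->
  exists L, (weighted_sum c 2 @ \oo --> L) /\ forall m, (2 <= m)%N -> `|weighted_sum c 2 m - L| <= 4 * C / quarter m ^+ 3.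
Proof.
move=> C0 cC.
have q1 j : (2 <= j)%N -> quarter j <= quarter j ^+ 3.
  move=> j2; have h : 1 <= quarter j by apply: quarter_ge1; exact: ltn_trans j2.
  by rewrite -[leLHS]expr1 ler_weXn2l.
pose e m : R := 4 * C / quarter m ^+ 3.
have e0 : e @ \oo --> 0.
  apply: (@cvg_dist_le _ (fun m => 4 * C / quarter m) _ 2) => [m m2|].
    have q0 : 0 < quarter m by apply: quarter_gt0; exact: ltn_trans m2.
    rewrite subr0 ger0_norm /e ?divr_ge0 ?mulr_ge0 ?exprn_ge0 ?(ltW q0) //.
    by rewrite ler_wpM2l ?mulr_ge0 // lef_pV2 ?posrE ?exprn_gt0 // q1.
  by rewrite -[0](mulr0 (4 * C)); apply: cvgMr; exact: cvg_inv_quarter.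
have [|L SL HL] := @cvg_tail (weighted_sum c 2) e 2 _ e0; last by exists L.
move=> m n /andP[m2 mn]; rewrite (weighted_sum_cat c m2 mn) addrC addKr.
have m0 : (0 < m)%N by exact: ltn_trans m2.
have qm := quarter_gt0 m0.
have -> : e m = 4 * (C / quarter m ^+ 2) / quarter m by rewrite /e; field; rewrite gt_eqF.
apply: weighted_sum_tail => //; first by rewrite divr_ge0 // exprn_ge0 // ltW.
move=> j /andP[mj _]; apply: (le_trans (cC j (leq_trans m2 mj))).
rewrite -mulrA ler_wpM2l // mulrC ler_pdivlMr ?exprn_gt0 // [leRHS]exprS ler_wpM2l ?quarter_ge0 //.
by rewrite lerXn2r ?nnegrE ?quarter_ge0 // ler_quarter.
Qed.

Lemma cvg_average (e : nat -> R) : e @ \oo --> 0 ->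
  (fun n => (\sum_(1 <= j < n) e j) / n.-1%:R) @ \oo --> 0.
Proof.
move=> e0; have e1 : (fun n => e n.+1) @ \oo --> 0 by rewrite cvg_shiftS.
rewrite -2!cvg_shiftS; apply: cvg_trans (cesaro e1); apply: near_eq_cvg.
by near=> n; rewrite /arithmetic_mean seriesEnat /= big_add1 mulrC.
Unshelve. all: by end_near. Qed.

End Sequences.

(** * Consequences of the split for the centred index *)

Section SplitConsequences.
Variables (R : realType) (k : nat).

Local Notation q := (@quarter R).
Local Notation mu := (mu R k).
Local Notation Zb := (@Zbar R k _).

Definition toll_root n (t : rrt n) : R := (attach_gain k (root_degree t))%:R.

Lemma toll_rootE n (t : rrt n) :
  toll_root t = \sum_(0 <= l < k) 'C(k, l)%:R * Rpow R l t.
Proof. exact: attach_gain_binomial. Qed.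

Lemma tollE n j (ts : rrt j * rrt (n - j)) :
  toll R k ts = toll_root ts.1 + toll_root ts.2 + (mu j + mu (n - j)%N - mu n).
Proof.
rewrite /toll !toll_rootE -big_split /= !addrA; do 3!congr (_ + _).
by apply: eq_bigr => l _; rewrite mulrDr.
Qed.

(** Centring the split: after subtraction of the means, the two parts
    contribute their centred indices and the toll collects all the rest. *)
Lemma mean_split_bar (Phi : R -> R) n : (2 <= n)%N ->
  unif_mean (fun t : rrt n => Phi (Zb t)) =
  (\sum_(1 <= j < n) unif_mean (fun ts : rrt j * rrt (n - j) =>
     Phi (Zb ts.1 + Zb ts.2 + toll R k ts))) / n.-1%:R.
Proof.
case: n => [|[|n]] // _.
rewrite (mean_split k (fun z => Phi (z%:R - mu n.+2))); congr (_ / _).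
apply: eq_bigr => j _; apply: eq_mean => ts; rewrite tollE /Zbar /toll_root !natrD.
congr Phi; ring.
Qed.

Lemma mean_Zbar n : unif_mean (fun t : rrt n => Zb t) = 0.
Proof. by rewrite meanB mean_cst ?card_rrt_gt0 // subrr. Qed.

Lemma rrt1_degree (t : rrt 1) v : degree (rrt_adj t) v = 0%N.
Proof.
by rewrite degreeE big_ord1 ord1 /rrt_adj orbb; case: is_parentP => // -[[]].
Qed.

Lemma Z_size1 (hk : (2 <= k)%N) (t : rrt 1) : Z k t = 0%N.
Proof. by rewrite /Z /zagreb big_ord1 rrt1_degree exp0n //; exact: ltn_trans hk. Qed.

Lemma mu_size1 (hk : (2 <= k)%N) : mu 1 = 0.
Proof.
rewrite -[RHS](mean_cst (card_rrt_gt0 1)); apply: eq_mean => t.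
by rewrite Z_size1 //.
Qed.

Lemma Zbar_size1 (hk : (2 <= k)%N) (t : rrt 1) : Zb t = 0.
Proof. by rewrite /Zbar Z_size1 // mu_size1 // subr0. Qed.

Lemma mean_sqr_le (T : finType) (f : T -> R) M : (0 < #|T|)%N -> 0 <= M ->
  unif_mean (fun t => f t ^+ 4) <= M ^+ 4 -> unif_mean (fun t => f t ^+ 2) <= M ^+ 2.
Proof.
move=> T0 M0 h; have := @mean_CauchySchwarz R T (fun t => f t ^+ 2) (fun _ => 1).
rewrite expr1n mean_cst // mulr1.
rewrite (eq_mean (g := fun t => f t ^+ 2)); last by move=> t; rewrite mulr1.
rewrite (@eq_mean _ _ (fun t => (f t ^+ 2) ^+ 2) (fun t => f t ^+ 4)); last by move=> t; rewrite -exprM.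
move=> h2; rewrite -(ler_pXn2r (n := 2)) ?nnegrE ?sqr_ge0 //.
  by rewrite -exprM; exact: le_trans h2 h.
by apply: mean_ge0 => t; exact: sqr_ge0.
Qed.

Lemma mean_norm_le (T : finType) (f : T -> R) M : (0 < #|T|)%N -> 0 <= M ->
  unif_mean (fun t => f t ^+ 2) <= M ^+ 2 -> unif_mean (fun t => `|f t|) <= M.
Proof.
move=> T0 M0 h; have := @mean_CauchySchwarz R T (fun t => `|f t|) (fun _ => 1).
rewrite expr1n mean_cst // mulr1.
rewrite (eq_mean (g := fun t => `|f t|)); last by move=> t; rewrite mulr1.
rewrite (@eq_mean _ _ (fun t => `|f t| ^+ 2) (fun t => f t ^+ 2)); last by move=> t; rewrite real_normK ?num_real.
move=> h2; rewrite -(ler_pXn2r (n := 2)) ?nnegrE //; first exact: le_trans h2 h.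
by apply: mean_ge0.
Qed.

Lemma mean_mul_le (T : finType) (f g : T -> R) A B : 0 <= A -> 0 <= B ->
  (0 < #|T|)%N -> unif_mean (fun t => f t ^+ 2) <= A ^+ 2 -> unif_mean (fun t => g t ^+ 2) <= B ^+ 2 ->
  `|unif_mean (fun t => f t * g t)| <= A * B.
Proof.
move=> A0 B0 T0 fA gB.
rewrite -(ler_pXn2r (n := 2)) ?nnegrE ?mulr_ge0 // real_normK ?num_real // [leRHS]exprMn.
have h := mean_CauchySchwarz f g. apply: (le_trans h); apply: ler_pM => //.
  by apply: mean_ge0 => t; exact: sqr_ge0.
by apply: mean_ge0 => t; exact: sqr_ge0.
Qed.

Lemma toll_root_moment : exists2 K : R, 1 <= K &
  forall n, (0 < n)%N -> unif_mean (fun t : rrt n => toll_root t ^+ 4) <= (K * q n) ^+ 4.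
Proof.
have [C C0 HC] := attach_gain_moment4 R k; exists (1 + C); first by lra.
case=> // n _; rewrite exprMn quarter4; apply: (le_trans (HC n)); rewrite ler_wpM2r //.
have h : 1 <= (1 + C) ^+ 3 by rewrite exprn_ege1 //; lra.
by rewrite exprS; nra.
Qed.

Lemma sum_prev_rev (F : nat -> R) n :
  \sum_(1 <= j < n) F (n - j)%N = \sum_(1 <= j < n) F j.
Proof.
case: n => [|n]; first by rewrite !big_geq.
by rewrite [LHS]big_nat_rev /=; apply: eq_big_nat => j /andP[j1 jn]; congr F; lia.
Qed.

Lemma b_mean_toll n : b R k n = 2 / n.-1%:R * \sum_(1 <= j < n) unif_mean (@toll_root j).
Proof.
rewrite /b; under eq_bigr do rewrite mulrCA mulr_sumr.
rewrite -mulr_sumr exchange_big /=; congr (_ * _); apply: eq_bigr => j _.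
rewrite (eq_mean (@toll_rootE j)) mean_sum.
by apply: eq_bigr => l _; rewrite meanZ.
Qed.

Lemma mu_rec n : (2 <= n)%N -> mu n = 2 / n.-1%:R * \sum_(1 <= j < n) mu j + b R k n.
Proof.
case: n => [|[|n]] // _; rewrite {1}/Defs.mu (mean_split k (fun z => z%:R)) b_mean_toll -mulrDr -big_split /=.
rewrite [RHS]mulrAC; congr (_ * _).
have E : \sum_(1 <= j < n.+2) unif_mean (fun ts : rrt j * rrt (n.+2 - j) =>
     (Z k ts.1 + Z k ts.2 + (attach_gain k (root_degree ts.1) + attach_gain k (root_degree ts.2)))%:R : R)
   = \sum_(1 <= j < n.+2) ((mu j + unif_mean (@toll_root j)) +
       (mu (n.+2 - j)%N + unif_mean (@toll_root (n.+2 - j)))).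
  apply: eq_bigr => j _; rewrite mean_prod.
  rewrite (eq_mean (g := fun t : rrt j => (Z k t)%:R + toll_root t
     + (mu (n.+2 - j)%N + unif_mean (@toll_root (n.+2 - j))))).
    by rewrite !meanD !mean_cst ?card_rrt_gt0.
  move=> t; rewrite (eq_mean (g := fun t' : rrt (n.+2 - j) => ((Z k t)%:R + toll_root t)
     + ((Z k t')%:R + toll_root t'))); last by move=> t'; rewrite /toll_root !natrD; ring.
  by rewrite !meanD !mean_cst ?card_rrt_gt0.
rewrite E big_split /= (sum_prev_rev (fun j => mu j + unif_mean (@toll_root j))).
by rewrite mulr2n mulrDl mul1r.
Qed.

Lemma average_le (F : nat -> R) n B : (2 <= n)%N -> (forall j, (1 <= j < n)%N -> F j <= B) ->
  (\sum_(1 <= j < n) F j) / n.-1%:R <= B.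
Proof.
case: n => [|[|n]] // _ FB; rewrite ler_pdivrMr ?ltr0n //=.
apply: (le_trans (ler_sum_nat FB)); rewrite sumr_const_nat subSS subn0 mulr_natr //.
Qed.

Lemma b_quarter_bound : exists2 K : R, 0 <= K & forall n, (2 <= n)%N -> 0 <= b R k n <= K * q n.
Proof.
have [K K1 HK] := toll_root_moment; exists (2 * K); first by lra.
move=> n n2; rewrite b_mean_toll; apply/andP; split.
  apply: mulr_ge0; first by rewrite divr_ge0.
  by apply: sumr_ge0 => j _; apply: mean_ge0 => t; rewrite /toll_root.
rewrite mulrAC -mulrA -mulrA ler_wpM2l //; apply: average_le => // j /andP[j1 jn].
apply: (@le_trans _ _ (unif_mean (fun t : rrt j => `|toll_root t|))).
  by apply: ler_mean => t; exact: ler_norm.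
apply: (@le_trans _ _ (K * q j)); last by rewrite ler_wpM2l ?ler_quarter 1?ltnW //; lra.
have KQ : 0 <= K * q j by rewrite mulr_ge0 ?quarter_ge0 //; lra.
apply: mean_norm_le => //; first exact: card_rrt_gt0.
by apply: mean_sqr_le => //; [exact: card_rrt_gt0|exact: HK].
Qed.
End SplitConsequences.

(** * Asymptotics of the mean and of the variance *)

Section MeanAndVariance.
Variables (R : realType) (k : nat).
Hypothesis hk : (2 <= k)%N.

Local Notation q := (@quarter R).
Local Notation mu := (mu R k).
Local Notation Zb := (@Zbar R k _).
Local Notation toll_root := (@toll_root R k _).
Local Notation v n := (unif_mean (fun t : rrt n => Zb t ^+ 2)).

Lemma b_size2 : b R k 2 = 2.
Proof.
rewrite b_mean_toll big_nat1 divr1 (eq_mean (g := fun _ : rrt 1 => 1)).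
  by rewrite mean_cst ?card_rrt_gt0 // mulr1.
move=> t; rewrite /toll_root root_degreeE rrt1_degree /attach_gain exp1n exp0n //; exact: ltn_trans hk.
Qed.

(** The sequence b is O(n^(1/4)), so the solution of the recurrence is linear
    with an error O(n^(1/4)). The limit is positive because b is
    nonnegative and b_2 = 2. *)
Lemma mu_asymptotics : exists muk : R, [/\ 0 < muk,
   (fun n => 2 * weighted_sum (b R k) 2 n) @ \oo --> muk &
   exists2 D, 0 <= D & forall n, (0 < n)%N -> `|mu n - muk * n%:R| <= D * q n].
Proof.
have [K K0 HK] := b_quarter_bound R k.
have bK j : (2 <= j)%N -> `|b R k j| <= K * q j.
  by move=> /HK/andP[b0 bq]; rewrite ger0_norm.
have [L [cL HL]] := cvg_weighted_sum_rate K0 bK; exists (2 * L); split.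
- suff : 3^-1 <= L by lra.
  apply: (cvgr_to_ge cL); near=> n.
  have n3 : (3 <= n)%N by near: n; exact: nbhs_infty_ge.
  rewrite (@weighted_sum_cat _ (b R k) 2 3 n) // /weighted_sum big_nat1 b_size2.
  rewrite -[leLHS]addr0 lerD //; first by rewrite natrM; lra.
  rewrite big_nat_cond; apply: sumr_ge0 => j /andP[/andP[j3 _] _].
  by rewrite divr_ge0 //; have /andP[] := HK j (ltnW j3).
- by apply: cvgMr.
(* The second term takes care of n = 1. *)
exists (9 * K + `|2 * L|); first by rewrite addr_ge0 // mulr_ge0.
case=> [|[|n]] // _.
  by rewrite (mu_size1 R hk) sub0r normrN mulr1 /quarter !sqrtr1 mulr1 lerDr mulr_ge0.
set m := n.+2; have m2 : (2 <= m)%N by [].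
rewrite (split_recurrence (mu_size1 R hk) (@mu_rec R k) m2).
have q0 : 0 < q m by exact: quarter_gt0.
have -> : b R k m + 2 * m%:R * weighted_sum (b R k) 2 m - 2 * L * m%:R =
  b R k m + 2 * m%:R * (weighted_sum (b R k) 2 m - L) by ring.
apply: (@le_trans _ _ (9 * K * q m)); last by rewrite ler_wpM2r ?lerDl // ltW.
apply: (le_trans (ler_normD _ _)).
have h : `|2 * m%:R * (weighted_sum (b R k) 2 m - L)| <= 8 * K * q m.
  rewrite normrM ger0_norm ?mulr_ge0 //.
  have -> : 8 * K * q m = 2 * m%:R * (4 * K / q m ^+ 3).
    by rewrite -(quarter4 R m); field; rewrite gt_eqF.
  by rewrite ler_wpM2l ?mulr_ge0 // HL.
have := bK _ m2; lra.
Unshelve. all: by end_near. Qed.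

Lemma pow4_sum_le (x y : R) : (x + y) ^+ 4 <= 8 * (x ^+ 4 + y ^+ 4).
Proof.
have h (a b : R) : (a + b) ^+ 2 <= 2 * (a ^+ 2 + b ^+ 2) by have := sqr_ge0 (a - b); nra.
have := h (x ^+ 2) (y ^+ 2); rewrite -!exprM => h2.
have h1 := h x y.
have : ((x + y) ^+ 2) ^+ 2 <= (2 * (x ^+ 2 + y ^+ 2)) ^+ 2.
  by rewrite lerXn2r ?nnegrE ?sqr_ge0 // mulr_ge0 // addr_ge0 // sqr_ge0.
rewrite -exprM exprMn; lra.
Qed.

(** The linear parts of the three means in the toll cancel, which leaves terms
    of order n^(1/4). *)
Lemma toll_moment : exists2 T : R, 0 <= T & forall n j, (1 <= j < n)%N ->
   unif_mean (fun ts : rrt j * rrt (n - j) => toll R k ts ^+ 4) <= (T * q n) ^+ 4.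
Proof.
have [muk [_ _ [D D0 HD]]] := mu_asymptotics.
have [K K1 HK] := toll_root_moment R k.
exists (1 + 64 * (2 * K ^+ 4 + (3 * D) ^+ 4)).
  by rewrite addr_ge0 // mulr_ge0 // addr_ge0 ?mulr_ge0 ?exprn_ge0 ?mulr_ge0 //; lra.
move=> n j /andP[j1 jn].
set c := mu j + mu (n - j)%N - mu n.
have n0 : (0 < n)%N by exact: leq_trans jn.
have nj0 : (0 < n - j)%N by rewrite subn_gt0.
have qn0 := quarter_gt0 R n0.
have qj : q j <= q n by rewrite ler_quarter // ltnW.
have qnj : q (n - j)%N <= q n by rewrite ler_quarter // leq_subr.
have hc : `|c| <= 3 * D * q n.
  have -> : c = (mu j - muk * j%:R) + (mu (n - j)%N - muk * (n - j)%:R) - (mu n - muk * n%:R).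
    by rewrite /c natrB ?(ltnW jn) //; ring.
  apply: (le_trans (ler_normB _ _)); apply: (le_trans (lerD (ler_normD _ _) (lexx _))).
  have h1 := HD j j1; have h2 := HD _ nj0; have h3 := HD n n0.
  have h4 : D * q j <= D * q n by rewrite ler_wpM2l.
  have h5 : D * q (n - j)%N <= D * q n by rewrite ler_wpM2l.
  lra.
have hY m : (0 < m)%N -> q m <= q n ->
    unif_mean (fun t : rrt m => toll_root t ^+ 4) <= K ^+ 4 * q n ^+ 4.
  move=> m0 qm; apply: (le_trans (HK m m0)); rewrite -exprMn lerXn2r ?nnegrE ?mulr_ge0 ?quarter_ge0 //; try lra.
  by rewrite ler_wpM2l //; lra.
apply: (@le_trans _ _ (unif_mean (fun ts : rrt j * rrt (n - j) =>
    64 * (toll_root ts.1 ^+ 4 + toll_root ts.2 ^+ 4) + 64 * c ^+ 4))).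
  apply: ler_mean => ts; rewrite tollE -/c.
  have h1 := pow4_sum_le (toll_root ts.1 + toll_root ts.2) c.
  have h2 := pow4_sum_le (toll_root ts.1) (toll_root ts.2).
  have c4 : 0 <= c ^+ 4 by rewrite (exprM _ 2 2) sqr_ge0.
  lra.
rewrite mean_prod.
rewrite (eq_mean (g := fun t : rrt j => 64 * toll_root t ^+ 4 +
   (64 * unif_mean (fun t : rrt (n - j) => toll_root t ^+ 4) + 64 * c ^+ 4))); last first.
  move=> t; rewrite (eq_mean (g := fun t' : rrt (n - j) => 64 * toll_root t ^+ 4 +
     64 * toll_root t' ^+ 4 + 64 * c ^+ 4)); last by move=> t' /=; ring.
  by rewrite !meanD !meanZ !mean_cst ?card_rrt_gt0 // addrA.
rewrite meanD meanZ mean_cst ?card_rrt_gt0 //.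
have h1 := hY j j1 qj; have h2 := hY _ nj0 qnj.
have c4 : c ^+ 4 <= (3 * D) ^+ 4 * q n ^+ 4.
  rewrite -exprMn (exprM c 2 2) (exprM _ 2 2) lerXn2r ?nnegrE ?sqr_ge0 //.
  by rewrite -(real_normK (num_real c)) lerXn2r ?nnegrE // !mulr_ge0 // ltW.
set s := 64 * (2 * K ^+ 4 + (3 * D) ^+ 4).
have s0 : 0 <= s by rewrite mulr_ge0 // addr_ge0 ?mulr_ge0 ?exprn_ge0 ?mulr_ge0 //; lra.
rewrite exprMn; apply: (@le_trans _ _ (s * q n ^+ 4)); first by rewrite /s; lra.
rewrite ler_wpM2r ?exprn_ge0 ?(ltW qn0) //.
have : 1 <= (1 + s) ^+ 3 by rewrite exprn_ege1 //; lra.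
by rewrite exprS; nra.
Qed.

(** The powers of the root degree combine into the gain at the root. *)
Lemma betaE n : beta R k n = (\sum_(1 <= j < n)
    (unif_mean (fun ts : rrt j * rrt (n - j) => toll R k ts ^+ 2)
     + 4 * unif_mean (fun t : rrt j => Zb t * toll_root t))) / n.-1%:R.
Proof.
rewrite /beta mulrC; congr (_ / _); apply: eq_bigr => j _; congr (_ + 4 * _).
rewrite (eq_mean (g := fun t : rrt j => \sum_(0 <= l < k) 'C(k, l)%:R * (Zb t * Rpow R l t))).
  by rewrite mean_sum; apply: eq_bigr => l _; rewrite meanZ.
move=> t; rewrite toll_rootE mulr_sumr; apply: eq_bigr => l _; exact: mulrCA.
Qed.

Lemma mean_affine (T : finType) (f g h : T -> R) c d : (0 < #|T|)%N ->
  unif_mean (fun t => f t + 2 * g t + c * h t + d) =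
  unif_mean f + 2 * unif_mean g + c * unif_mean h + d.
Proof. by move=> T0; rewrite !meanD !meanZ mean_cst. Qed.

(** Squaring the centred split: the product of the two centred indices has
    mean zero by independence, and the toll is correlated with each index
    only through the root degree of its own part. *)
Lemma var_rec n : (2 <= n)%N -> v n = 2 / n.-1%:R * \sum_(1 <= j < n) v j + beta R k n.
Proof.
move=> n2; rewrite (mean_split_bar k (fun z => z ^+ 2) n2) betaE.
have E : \sum_(1 <= j < n) unif_mean (fun ts : rrt j * rrt (n - j) =>
    (Zb ts.1 + Zb ts.2 + toll R k ts) ^+ 2)
  = \sum_(1 <= j < n) (v j + v (n - j)%N
      + unif_mean (fun ts : rrt j * rrt (n - j) => toll R k ts ^+ 2)
      + 2 * unif_mean (fun t : rrt j => Zb t * toll_root t)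
      + 2 * unif_mean (fun t : rrt (n - j) => Zb t * toll_root t)).
  apply: eq_bigr => j _; set c := mu j + mu (n - j)%N - mu n.
  rewrite (eq_mean (g := fun ts : rrt j * rrt (n - j) => toll R k ts ^+ 2 +
    (Zb ts.1 ^+ 2 + Zb ts.2 ^+ 2 + 2 * Zb ts.1 * Zb ts.2 +
     2 * (Zb ts.1 + Zb ts.2) * (toll_root ts.1 + toll_root ts.2 + c)))); last first.
    by move=> ts; rewrite [in LHS]tollE [in RHS]tollE -/c; ring.
  rewrite meanD [X in _ + X]mean_prod.
  set Y' := unif_mean (fun t : rrt (n - j) => toll_root t).
  set ZY' := unif_mean (fun t : rrt (n - j) => Zb t * toll_root t).
  rewrite (@eq_mean _ _ _ (fun t : rrt j => Zb t ^+ 2 + 2 * (Zb t * toll_root t) +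
       (2 * (Y' + c)) * Zb t + (v (n - j)%N + 2 * ZY'))); last first.
    move=> t; rewrite (eq_mean (g := fun t' : rrt (n - j) => Zb t' ^+ 2 + 2 * (Zb t' * toll_root t')
      + (2 * Zb t + 2 * (toll_root t + c)) * Zb t' + (2 * Zb t) * toll_root t'
      + (Zb t ^+ 2 + 2 * Zb t * (toll_root t + c)))); last by move=> t' /=; ring.
    by rewrite 4!meanD !meanZ mean_Zbar mean_cst ?card_rrt_gt0 // -/Y' -/ZY'; ring.
  rewrite (mean_affine (fun t : rrt j => Zb t ^+ 2) (fun t => Zb t * toll_root t)) ?card_rrt_gt0 //.
  by rewrite mean_Zbar /ZY'; ring.
rewrite E !big_split /= (sum_prev_rev (fun j => v j)) -!mulr_sumr.
rewrite (sum_prev_rev (fun j => unif_mean (fun t : rrt j => Zb t * toll_root t))).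
by case: n n2 {E} => [|[|n]] // _; field; rewrite pnatr_eq0.
Qed.

Lemma second_moment_size1 : v 1%N = 0.
Proof.
rewrite -[RHS](mean_cst (card_rrt_gt0 1)); apply: eq_mean => t.
by rewrite Zbar_size1 // expr0n.
Qed.

Lemma second_moment_ge0 n : 0 <= v n.
Proof. by apply: mean_ge0 => t; exact: sqr_ge0. Qed.

(** By the Cauchy-Schwarz inequality, the cross term in beta is controlled by
    the standard deviations of smaller trees. The bound is affine in s,
    which makes the bootstrap of variance_linear possible. *)
Lemma beta_bound : exists2 T : R, 1 <= T & forall n s, (2 <= n)%N -> 0 <= s ->
  (forall j, (0 < j < n)%N -> v j <= s ^+ 2 * j%:R) -> `|beta R k n| <= T * (1 + s) * q n ^+ 3.
Proof.
have [T T0 HT] := toll_moment; have [K K1 HK] := toll_root_moment R k.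
exists (T ^+ 2 + 4 * K); first by have := sqr_ge0 T; lra.
move=> n s n2 s0 vs; rewrite betaE normrM [`|_^-1|]ger0_norm ?invr_ge0 //.
have n0 : (0 < n)%N by exact: ltnW.
have q1 : 1 <= q n by exact: quarter_ge1.
apply: le_trans (_ : (\sum_(1 <= j < n) `|(unif_mean (fun ts : rrt j * rrt (n - j) => toll R k ts ^+ 2)
     + 4 * unif_mean (fun t : rrt j => Zb t * toll_root t))|) / n.-1%:R <= _).
  by rewrite ler_wpM2r ?invr_ge0 // ler_norm_sum.
apply: average_le => // j jn; have /andP[j1 jn'] := jn.
have qj : 0 < q j by exact: quarter_gt0.
have qjn : q j <= q n by rewrite ler_quarter // ltnW.
have h1 : unif_mean (fun ts : rrt j * rrt (n - j) => toll R k ts ^+ 2) <= (T * q n) ^+ 2.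
  apply: mean_sqr_le; rewrite ?mulr_ge0 ?quarter_ge0 //; last exact: HT.
  by rewrite card_prod muln_gt0 !card_rrt_gt0.
have h2 : `|unif_mean (fun t : rrt j => Zb t * toll_root t)| <= (s * q j ^+ 2) * (K * q j).
  apply: mean_mul_le; rewrite ?mulr_ge0 ?exprn_ge0 ?(ltW qj) ?card_rrt_gt0 //; try lra.
    by rewrite exprMn -exprM quarter4; exact: vs.
  apply: mean_sqr_le; rewrite ?card_rrt_gt0 ?mulr_ge0 ?(ltW qj) //; try lra.
  exact: HK.
have h3 : 0 <= unif_mean (fun ts : rrt j * rrt (n - j) => toll R k ts ^+ 2).
  by apply: mean_ge0 => ts; exact: sqr_ge0.
apply: (le_trans (ler_normD _ _)); rewrite (ger0_norm h3) normrM ger0_norm //.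
have h4 : (T * q n) ^+ 2 <= T ^+ 2 * q n ^+ 3.
  by rewrite exprMn ler_wpM2l ?sqr_ge0 // [leRHS]exprSr ler_peMr ?sqr_ge0.
have h5 : (s * q j ^+ 2) * (K * q j) <= s * K * q n ^+ 3.
  have -> : (s * q j ^+ 2) * (K * q j) = s * K * q j ^+ 3 by ring.
  by rewrite ler_wpM2l ?mulr_ge0 ?lerXn2r ?nnegrE ?quarter_ge0 //; lra.
have q3 : 0 <= q n ^+ 3 by rewrite exprn_ge0 // quarter_ge0.
have T2 := sqr_ge0 T.
have : 0 <= T ^+ 2 * s * q n ^+ 3 by apply: mulr_ge0 => //; apply: mulr_ge0.
have : 0 <= K * q n ^+ 3 by rewrite mulr_ge0 //; lra.
have -> : (T ^+ 2 + 4 * K) * (1 + s) * q n ^+ 3 = T ^+ 2 * q n ^+ 3 + 4 * (s * K * q n ^+ 3)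
  + T ^+ 2 * s * q n ^+ 3 + 4 * (K * q n ^+ 3) by ring.
lra.
Qed.

(** Bootstrap: if the bound holds with s^2 below n, then it holds at n with 9
    T (1 + s), which is at most s^2 for s = 18 T. *)
Lemma variance_linear : exists2 s : R, 0 <= s & forall n, (0 < n)%N -> v n <= s ^+ 2 * n%:R.
Proof.
have [T T1 HT] := beta_bound; exists (18 * T); first by lra.
elim/ltn_ind => -[|[|n]] // IH _; first by rewrite second_moment_size1 mulr1 sqr_ge0.
set m := n.+2 in IH *; set s := 18 * T; have s0 : 0 <= s by rewrite /s; lra.
rewrite (split_recurrence (a := fun n => v n) second_moment_size1 var_rec) //.
have hb j : (2 <= j < m.+1)%N -> `|beta R k j| <= T * (1 + s) * q j ^+ 3.
  move=> /andP[j2 jm]; apply: HT => // i /andP[i0 ij]; apply: IH => //.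
  exact: leq_trans ij _.
have C0 : 0 <= T * (1 + s) by rewrite mulr_ge0 //; lra.
have hw : `|weighted_sum (beta R k) 2 m| <= 4 * (T * (1 + s)) / q 2.
  by apply: weighted_sum_tail => // j /andP[j2 jm]; apply: hb; rewrite j2 ltnS ltnW.
have hbm : beta R k m <= T * (1 + s) * q m ^+ 3.
  by apply: le_trans (ler_norm _) _; apply: hb; rewrite !ltnSn.
have q1 : 1 <= q m by exact: quarter_ge1.
have h3 : q m ^+ 3 <= m%:R by rewrite -(quarter4 R m) [leRHS]exprSr ler_peMr ?exprn_ge0 ?quarter_ge0.
have h4 : weighted_sum (beta R k) 2 m <= 4 * (T * (1 + s)).
  apply: le_trans (ler_norm _) _; apply: (le_trans hw).
  by rewrite ler_pdivrMr ?quarter_gt0 // ler_peMr ?mulr_ge0 ?quarter_ge1 //; lra.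
have m0 : 0 <= m%:R :> R by [].
apply: (@le_trans _ _ (9 * (T * (1 + s)) * m%:R)).
  have -> : 9 * (T * (1 + s)) * m%:R = T * (1 + s) * m%:R + 2 * m%:R * (4 * (T * (1 + s))) by ring.
  by apply: lerD; [apply: (le_trans hbm); rewrite ler_wpM2l | rewrite ler_wpM2l ?mulr_ge0].
rewrite ler_wpM2r // /s; nra.
Qed.

(** Convergence comes from the solution of the recurrence, and positivity of
    the limit from the lower bound of variance_Z_lower. *)
Lemma variance_asymptotics : exists sigma : R, [/\ 0 < sigma,
   (fun n => 2 * weighted_sum (beta R k) 2 n) @ \oo --> sigma ^+ 2 &
   exists2 E, 0 <= E & forall n, (0 < n)%N -> `|v n - sigma ^+ 2 * n%:R| <= E * q n ^+ 3].
Proof.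
have [T T1 HT] := beta_bound; have [s s0 Hs] := variance_linear.
set C := T * (1 + s); have C0 : 0 <= C by rewrite mulr_ge0 //; lra.
have bC j : (2 <= j)%N -> `|beta R k j| <= C * q j ^+ 3.
  by move=> j2; apply: HT => // i /andP[i0 _]; exact: Hs.
have [L [cL HL]] := cvg_weighted_sum C0 bC.
have vL n : (2 <= n)%N -> `|v n - 2 * L * n%:R| <= 9 * C * q n ^+ 3.
  move=> n2; rewrite (split_recurrence (a := fun n => v n) second_moment_size1 var_rec) //.
  have q0 : 0 < q n by apply: quarter_gt0; exact: ltnW.
  have -> : beta R k n + 2 * n%:R * weighted_sum (beta R k) 2 n - 2 * L * n%:R =
    beta R k n + 2 * n%:R * (weighted_sum (beta R k) 2 n - L) by ring.
  apply: (le_trans (ler_normD _ _)).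
  have h : `|2 * n%:R * (weighted_sum (beta R k) 2 n - L)| <= 8 * C * q n ^+ 3.
    rewrite normrM ger0_norm ?mulr_ge0 //.
    have -> : 8 * C * q n ^+ 3 = 2 * n%:R * (4 * C / q n).
      by rewrite -(quarter4 R n); field; rewrite gt_eqF.
    by rewrite ler_wpM2l ?mulr_ge0 // HL.
  have := bC _ n2; lra.
(* The lower bound (n - 6)/2 is at least n/4 from n = 12 on. *)
have Lpos : 4^-1 <= 2 * L.
  have c2L : 2 * L + 9 * C / q n @[n --> \oo] --> 2 * L.
    rewrite -[X in _ --> X]addr0; apply: cvgD; first exact: cvg_cst.
    by rewrite -(mulr0 (9 * C)); apply: cvgMr; exact: cvg_inv_quarter.
  apply: (cvgr_to_ge c2L); near=> n.
  have n12 : (12 <= n)%N by near: n; exact: nbhs_infty_ge.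
  have q0 : 0 < q n by apply: quarter_gt0; exact: ltn_trans n12.
  have := vL n (ltn_trans _ n12); move=> /(_ isT); rewrite ler_norml => /andP[_ h].
  have nE : n = n.-1.+1 by rewrite prednK // (ltn_trans _ n12).
  have lo : (n.-1%:R - 5) / 2 <= v n.
    by have := variance_Z_lower R n.-1 hk; rewrite -nE.
  have n1E : n.-1%:R = n%:R - 1 :> R by rewrite [in RHS]nE -natr1 addrK.
  have n12R : 12 <= n%:R :> R by rewrite ler_nat.
  have n0 : 0 < n%:R :> R by lra.
  have -> : 2 * L + 9 * C / q n = (2 * L * n%:R + 9 * C * q n ^+ 3) / n%:R.
    by rewrite -(quarter4 R n); field; rewrite gt_eqF.
  rewrite ler_pdivlMr //; lra.
have L0 : 0 < 2 * L by lra.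
exists (Num.sqrt (2 * L)); split; first by rewrite sqrtr_gt0.
  by rewrite sqr_sqrtr ?(ltW L0) //; apply: cvgMr.
exists (9 * C + 2 * L); first by lra.
rewrite sqr_sqrtr ?(ltW L0) //; case=> [|[|n]] // _.
  rewrite second_moment_size1 sub0r normrN mulr1 /quarter !sqrtr1 expr1n mulr1 ger0_norm ?(ltW L0) //.
  by rewrite lerDr mulr_ge0.
apply: (le_trans (vL _ _)) => //; rewrite ler_wpM2r ?exprn_ge0 ?quarter_ge0 //.
by rewrite lerDl ltW.
Unshelve. all: by end_near. Qed.

End MeanAndVariance.

(** * Third and fourth moments *)

Section HigherMoments.
Variables (R : realType) (k : nat).
Hypothesis hk : (2 <= k)%N.

Local Notation q := (@quarter R).
Local Notation Zb := (@Zbar R k _).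
Local Notation v n := (unif_mean (fun t : rrt n => Zb t ^+ 2)).
Local Notation w n := (unif_mean (fun t : rrt n => Zb t ^+ 4)).

Lemma toll_mean : exists2 T : R, 0 <= T & forall n j, (1 <= j < n)%N ->
   unif_mean (fun ts : rrt j * rrt (n - j) => `|toll R k ts|) <= T * q n.
Proof.
have [T T0 HT] := toll_moment R hk; exists T => // n j jn.
have c0 : (0 < #|{: rrt j * rrt (n - j)}|)%N by rewrite card_prod muln_gt0 !card_rrt_gt0.
have q0 : 0 <= T * q n by rewrite mulr_ge0 // quarter_ge0.
by apply: mean_norm_le => //; apply: mean_sqr_le => //; exact: HT.
Qed.

(** A small perturbation in a fourth power is absorbed at the cost of a factor
    6/5. Any factor below 3/2 would do for fourth_moment. *)
Lemma pow4_perturb : exists2 C : R, 0 <= C &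
  forall x t : R, (x + t) ^+ 4 <= 6 / 5 * x ^+ 4 + C * t ^+ 4.
Proof.
(* Twice the square of a sum with weights 1 + 1/16 and 1 + 16; (17/16)^3 < 6/5. *)
exists (17 ^+ 3); first exact: exprn_ge0.
move=> x t.
have h (a b : R) : (a + b) ^+ 2 <= 17 / 16 * a ^+ 2 + 17 * b ^+ 2.
  by have := sqr_ge0 (a / 4 - 4 * b); nra.
have h1 := h x t; have h2 := h (17 / 16 * x ^+ 2) (17 * t ^+ 2).
have : ((x + t) ^+ 2) ^+ 2 <= (17 / 16 * x ^+ 2 + 17 * t ^+ 2) ^+ 2.
  by rewrite lerXn2r ?nnegrE ?sqr_ge0 // addr_ge0 // mulr_ge0 ?sqr_ge0 //; lra.
rewrite -exprM => h3; apply: (le_trans h3); apply: (le_trans h2).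
have -> : 17 / 16 * (17 / 16 * x ^+ 2) ^+ 2 + 17 * (17 * t ^+ 2) ^+ 2 =
  (17 / 16) ^+ 3 * x ^+ 4 + 17 ^+ 3 * t ^+ 4 by field.
rewrite lerD2r ler_wpM2r //; first by rewrite (exprM _ 2 2) sqr_ge0.
lra.
Qed.

Lemma mean_sum4 m n : unif_mean (fun ts : rrt m * rrt n => (Zb ts.1 + Zb ts.2) ^+ 4) =
  w m + 6 * v m * v n + w n.
Proof.
rewrite mean_prod.
pose c3 := unif_mean (fun t : rrt n => Zb t ^+ 3).
rewrite (@eq_mean _ _ _ (fun t : rrt m => Zb t ^+ 4 + 2 * (3 * v n * Zb t ^+ 2) + (4 * c3) * Zb t + w n)).
  rewrite mean_affine ?card_rrt_gt0 // meanZ mean_Zbar; ring.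
move=> t; rewrite (@eq_mean _ _ _ (fun t' : rrt n => Zb t' ^+ 4 +
   2 * (2 * Zb t * Zb t' ^+ 3 + 3 * Zb t ^+ 2 * Zb t' ^+ 2) + (4 * Zb t ^+ 3) * Zb t' + Zb t ^+ 4)).
  rewrite mean_affine ?card_rrt_gt0 // meanD !meanZ mean_Zbar -/c3; ring.
by move=> t' /=; ring.
Qed.

Lemma sum_sqr_prev n : \sum_(1 <= j < n.+1) j%:R ^+ 2 <= n.+1%:R ^+ 2 * n%:R / 3 :> R.
Proof.
elim: n => [|n IH]; first by rewrite big_geq // mulr0 mul0r.
rewrite big_nat_recr //=; move: IH; rewrite -(natr1 n.+1) -(natr1 n).
have : 0 <= n%:R :> R by [].
set x := n%:R; set S := \sum_(_ <= _ < _) _ => x0 IH.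
nra.
Qed.

(** The two parts contribute W (j^2 + (n - j)^2), whose average is at most 2/3
    of W n^2; the factor 6/5 keeps this at 4/5 < 1, so that W can be
    chosen to absorb the remaining terms. *)
Lemma fourth_moment : exists2 W : R, 0 <= W & forall n, (0 < n)%N -> w n <= W * n%:R ^+ 2.
Proof.
have [T T0 HT] := toll_moment R hk; have [s s0 Hs] := variance_linear R hk.
have [C C0 HC] := pow4_perturb.
have A0 : 0 <= (s ^+ 2) ^+ 2 by exact: sqr_ge0.
have D0 : 0 <= C * T ^+ 4 by apply: mulr_ge0 => //; exact: exprn_ge0.
pose B := 36 / 5 * (s ^+ 2) ^+ 2 + C * T ^+ 4.
have B0 : 0 <= B by rewrite /B; lra.
exists (5 * B); first by lra.
elim/ltn_ind => -[|[|n]] // IH _.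
  rewrite (eq_mean (g := fun _ : rrt 1 => 0)) ?mean_cst ?card_rrt_gt0 ?mulr_ge0 ?expr1n //; try lra.
  by move=> t; rewrite Zbar_size1 // expr0n.
rewrite (mean_split_bar k (fun z => z ^+ 4)) //.
set m := n.+2 in IH *.
have m0 : (0 < m)%N by [].
have term j : (1 <= j < m)%N ->
  unif_mean (fun ts : rrt j * rrt (m - j) => (Zb ts.1 + Zb ts.2 + toll R k ts) ^+ 4) <=
  6 / 5 * (w j + w (m - j)%N) + B * m%:R ^+ 2.
  move=> jm; have /andP[j1 jm'] := jm.
  have mj0 : (0 < m - j)%N by rewrite subn_gt0.
  apply: (@le_trans _ _ (unif_mean (fun ts : rrt j * rrt (m - j) =>
     6 / 5 * (Zb ts.1 + Zb ts.2) ^+ 4 + C * toll R k ts ^+ 4))).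
    by apply: ler_mean => ts; exact: HC.
  rewrite meanD !meanZ mean_sum4.
  have h1 := HT m j jm.
  have h2 : v j * v (m - j)%N <= (s ^+ 2) ^+ 2 * m%:R ^+ 2.
    have -> : (s ^+ 2) ^+ 2 * m%:R ^+ 2 = (s ^+ 2 * m%:R) * (s ^+ 2 * m%:R) :> R by ring.
    apply: ler_pM; rewrite ?second_moment_ge0 //.
      apply: (le_trans (Hs _ j1)); rewrite ler_wpM2l ?sqr_ge0 // ler_nat; exact: ltnW.
    apply: (le_trans (Hs _ mj0)); rewrite ler_wpM2l ?sqr_ge0 // ler_nat; exact: leq_subr.
  have h3 : (T * q m) ^+ 4 <= T ^+ 4 * m%:R ^+ 2.
    rewrite exprMn quarter4 ler_wpM2l ?exprn_ge0 // expr2 ler_peMl // ler1n //.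
  have h4 := le_trans h1 h3.
  have h5 : C * unif_mean (fun ts : rrt j * rrt (m - j) => toll R k ts ^+ 4) <= C * (T ^+ 4 * m%:R ^+ 2) by rewrite ler_wpM2l.
  rewrite /B; lra.
apply: (@le_trans _ _ ((\sum_(1 <= j < m) (6 / 5 * (w j + w (m - j)%N) + B * m%:R ^+ 2)) / m.-1%:R)).
  by rewrite ler_wpM2r ?invr_ge0 //; apply: ler_sum_nat.
rewrite big_split /= -mulr_sumr big_split /= (sum_prev_rev (fun j => w j)) sumr_const_nat.
have -> : (m - 1 = m.-1)%N by rewrite subn1.
have Sw : \sum_(1 <= j < m) w j <= 5 * B * (m%:R ^+ 2 * m.-1%:R / 3).
  apply: (@le_trans _ _ (\sum_(1 <= j < m) 5 * B * j%:R ^+ 2)).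
    by apply: ler_sum_nat => j /andP[j1 jm]; exact: IH.
  by rewrite -mulr_sumr ler_wpM2l ?sum_sqr_prev //; lra.
rewrite ler_pdivrMr ?ltr0n //= -[X in _ + X]mulr_natr.
have : 0 <= B * m%:R ^+ 2 * n.+1%:R by rewrite !mulr_ge0.
move: Sw => /=; lra.
Qed.

(** Integrating 2 r |z|^3 <= r^2 z^2 + z^4 with r = sqrt n. *)
Lemma third_moment : exists2 M : R, 0 <= M &
  forall n, (0 < n)%N -> unif_mean (fun t : rrt n => `|Zb t| ^+ 3) <= M * q n ^+ 6.
Proof.
have [W W0 HW] := fourth_moment; have [s s0 Hs] := variance_linear R hk.
exists ((s ^+ 2 + W) / 2); first by rewrite divr_ge0 // addr_ge0 ?sqr_ge0.
move=> n n0; have q0 := quarter_gt0 R n0.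
have q2 : 0 < 2 * q n ^+ 2 by rewrite mulr_gt0 // exprn_gt0.
rewrite -(ler_pM2l q2) -meanZ.
apply: (@le_trans _ _ (unif_mean (fun t : rrt n => n%:R * Zb t ^+ 2 + Zb t ^+ 4))).
  apply: ler_mean => t; rewrite -(quarter4 R n); set z := Zb t.
  have -> : z ^+ 4 = `|z| ^+ 4 by rewrite (exprM z 2 2) -(real_normK (num_real z)) -exprM.
  rewrite -(real_normK (num_real z)); set y := `|z|.
  have y0 : 0 <= y by exact: normr_ge0.
  have := mulr_ge0 (sqr_ge0 y) (sqr_ge0 (q n ^+ 2 - y)); rewrite -subr_ge0 => h.
  by rewrite -subr_ge0; apply: le_trans h _; rewrite le_eqVlt; apply/orP; left; apply/eqP; ring.
rewrite meanD meanZ.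
have h1 := Hs n n0; have h2 := HW n n0.
have h3 : n%:R * v n <= n%:R * (s ^+ 2 * n%:R) by rewrite ler_wpM2l.
have -> : 2 * q n ^+ 2 * ((s ^+ 2 + W) / 2 * q n ^+ 6) = (s ^+ 2 + W) * (n%:R ^+ 2).
  by rewrite -(quarter4 R n); field.
lra.
Qed.

End HigherMoments.

(** * Moments of the standard Gaussian density *)

Section Gaussian.
Variable R : realType.
Local Notation leb := (@lebesgue_measure R).
Local Notation phi := (@normal_pdf R 0 1).
Implicit Types f g : R -> R.

(** Integrals are taken against the density, for the Lebesgue measure, so that
    changes of variables and the Tonelli theorem apply directly. *)
Definition gauss_integrable f := leb.-integrable setT (EFin \o (fun x => f x * phi x)).

Definition gauss_mean f : R := \int[leb]_x (f x * phi x).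

Lemma phi_ge0 x : 0 <= phi x. Proof. exact: normal_pdf_ge0. Qed.

Lemma gauss_integrable_le f g : measurable_fun setT f -> (forall x, `|f x| <= g x) ->
  gauss_integrable g -> gauss_integrable f.
Proof.
move=> mf fg; apply: le_integrable => //.
  apply/measurable_EFinP; apply: measurable_funM => //; exact: measurable_normal_pdf.
move=> x _ /=; rewrite lee_fin !normrM; apply: ler_wpM2r => //.
exact: le_trans (fg x) (ler_norm _).
Qed.

Lemma gauss_integrableD f g : gauss_integrable f -> gauss_integrable g ->
  gauss_integrable (fun x => f x + g x).
Proof.
move=> fi gi; have := integrableD measurableT fi gi; apply: eq_integrable => // x _ /=.
by rewrite mulrDl EFinD.
Qed.

Lemma gauss_integrableZ c f : gauss_integrable f -> gauss_integrable (fun x => c * f x).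
Proof.
move=> fi; have := integrableZl measurableT c fi; apply: eq_integrable => // x _ /=.
by rewrite -mulrA EFinM.
Qed.

Lemma gauss_integrable_cst c : gauss_integrable (fun _ => c).
Proof.
have := integrableZl measurableT c (integrable_normal_pdf (0 : R) 1).
by apply: eq_integrable => // x _ /=; rewrite EFinM.
Qed.

Lemma gauss_mean_cst c : gauss_mean (fun _ => c) = c.
Proof.
rewrite /gauss_mean RintegralZl //; last exact: integrable_normal_pdf.
by rewrite /Rintegral integral_normal_pdf mulr1.
Qed.

Lemma gauss_meanD f g : gauss_integrable f -> gauss_integrable g ->
  gauss_mean (fun x => f x + g x) = gauss_mean f + gauss_mean g.
Proof.
move=> fi gi; rewrite /gauss_mean -RintegralD //; apply: eq_Rintegral => x _.
exact: mulrDl.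
Qed.

Lemma gauss_meanZ c f : gauss_integrable f -> gauss_mean (fun x => c * f x) = c * gauss_mean f.
Proof.
move=> fi; rewrite /gauss_mean -RintegralZl //; apply: eq_Rintegral => x _.
by rewrite mulrA.
Qed.

Lemma gauss_mean_le f g : gauss_integrable f -> gauss_integrable g -> (forall x, f x <= g x) ->
  gauss_mean f <= gauss_mean g.
Proof.
move=> fi gi fg; apply: le_Rintegral => // x _; rewrite ler_wpM2r //; exact: phi_ge0.
Qed.

Lemma gauss_mean_norm_le f g : measurable_fun setT f -> gauss_integrable g ->
  (forall x, `|f x| <= g x) -> `|gauss_mean f| <= gauss_mean g.
Proof.
move=> mf gi fg; have fi := gauss_integrable_le mf fg gi.
rewrite ler_norml; apply/andP; split.
  rewrite -mulN1r -gauss_meanZ //; apply: gauss_mean_le => //; first exact: gauss_integrableZ.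
  by move=> x; have := fg x; rewrite ler_norml mulN1r => /andP[].
by apply: gauss_mean_le => // x; exact: le_trans (ler_norm _) (fg x).
Qed.

Lemma eq_gauss_mean f g : f =1 g -> gauss_mean f = gauss_mean g.
Proof. by move=> fg; apply: eq_Rintegral => x _; rewrite fg. Qed.

(** Multiplying the standard density by this exponential gives s times the
    density of standard deviation s, whose integral is known. *)
Lemma gauss_quadratic (s : R) : 0 < s ->
  gauss_integrable (fun x => expR ((1 - s ^- 2) / 2 * x ^+ 2)) /\
  gauss_mean (fun x => expR ((1 - s ^- 2) / 2 * x ^+ 2)) = s.
Proof.
move=> s0; have sn0 : s != 0 by rewrite gt_eqF.
have E x : expR ((1 - s ^- 2) / 2 * x ^+ 2) * phi x = s * normal_pdf 0 s x.
  rewrite !normal_pdfE ?oner_neq0 // /normal_peak /normal_fun !subr0 expr1n mul1r.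
  rewrite mulrCA [RHS]mulrA; congr (_ * _).
    rewrite -mulrnAr sqrtrM ?sqr_ge0 // sqrtr_sqr (ger0_norm (ltW s0)) invfM mulrA divff // mul1r //.
  by rewrite -expRD; congr expR; field.
have Eint : leb.-integrable setT (fun x => (s * normal_pdf 0 s x)%:E).
  have := integrableZl measurableT s (integrable_normal_pdf (0 : R) s).
  by apply: eq_integrable => // x _ /=; rewrite EFinM.
split; first by move: Eint; apply: eq_integrable => // x _ /=; rewrite E.
rewrite /gauss_mean; under eq_Rintegral do rewrite E.
rewrite RintegralZl //; last exact: integrable_normal_pdf.
by rewrite /Rintegral integral_normal_pdf mulr1.
Qed.

(** Multiplying the standard density by this exponential shifts its mean. *)
Lemma gauss_shift (m : R) :
  gauss_integrable (fun x => expR (m * x - m ^+ 2 / 2)) /\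
  gauss_mean (fun x => expR (m * x - m ^+ 2 / 2)) = 1.
Proof.
have E x : expR (m * x - m ^+ 2 / 2) * phi x = normal_pdf m 1 x.
  rewrite !normal_pdfE ?oner_neq0 // /normal_fun subr0 expr1n mulrCA; congr (_ * _).
  by rewrite -expRD; congr expR; field.
split.
  by have := integrable_normal_pdf m 1; apply: eq_integrable => // x _ /=; rewrite E.
rewrite /gauss_mean; under eq_Rintegral do rewrite E.
by rewrite /Rintegral integral_normal_pdf.
Qed.

Lemma gauss_integrable_pow4 : gauss_integrable (fun x => x ^+ 4).
Proof.
have [i _] := @gauss_quadratic 2 (ltr0Sn _ _).
apply: gauss_integrable_le (gauss_integrableZ 64 i); first exact: exprn_measurable.
move=> x; rewrite ger0_norm; last by rewrite (exprM _ 2 2) sqr_ge0.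
set u := (1 - 2 ^- 2) / 2 * x ^+ 2.
have u0 : 0 <= u by rewrite mulr_ge0 ?sqr_ge0 //; lra.
have h : 1 + u / 2 <= expR (u / 2) by exact: expR_ge1Dx.
have -> : expR u = expR (u / 2) ^+ 2 by rewrite -expRM_natl mulr_natl; congr expR; field.
(* The exponent is u = 3/8 x^2, and exp u >= (u/2)^2. *)
have e0 : (u / 2) ^+ 2 <= expR (u / 2) ^+ 2.
  by rewrite lerXn2r ?nnegrE ?expR_ge0 ?divr_ge0 //; lra.
have -> : x ^+ 4 = 256 / 9 * (u / 2) ^+ 2 by rewrite /u; field.
have := sqr_ge0 (u / 2); lra.
Qed.

Lemma gauss_integrable_cube : gauss_integrable (fun x => `|x| ^+ 3).
Proof.
apply: gauss_integrable_le (gauss_integrableD (gauss_integrable_cst 1) gauss_integrable_pow4).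
  by apply: measurable_funX; exact: normr_measurable.
move=> x; have -> : x ^+ 4 = `|x| ^+ 4 by rewrite (exprM x 2 2) -(real_normK (num_real x)) -exprM.
rewrite normrX normr_id; set y := `|x|; have y0 : 0 <= y by exact: normr_ge0.
have [y1|y1] := leP y 1.
  have : y ^+ 3 <= 1 by exact: exprn_ile1.
  have : 0 <= y ^+ 4 by exact: exprn_ge0.
  lra.
have : y ^+ 3 <= y ^+ 4 by rewrite ler_weXn2l // ltW.
lra.
Qed.

Lemma gauss_integrable_sqr : gauss_integrable (fun x => x ^+ 2).
Proof.
apply: gauss_integrable_le (gauss_integrableD (gauss_integrable_cst 1) gauss_integrable_pow4).
  exact: exprn_measurable.
move=> x; rewrite ger0_norm ?sqr_ge0 //.
by rewrite (exprM x 2 2); have := sqr_ge0 (x ^+ 2 - 1); nra.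
Qed.

Lemma gauss_integrable_norm : gauss_integrable (fun x => `|x|).
Proof.
apply: gauss_integrable_le (gauss_integrableD (gauss_integrable_cst 1) gauss_integrable_sqr).
  exact: normr_measurable.
move=> x; rewrite normr_id -(real_normK (num_real x)).
by have := sqr_ge0 (`|x| - 1); nra.
Qed.

Lemma gauss_integrable_id : gauss_integrable (fun x => x).
Proof. by apply: gauss_integrable_le gauss_integrable_norm => //; exact: measurable_id. Qed.

(** The inequality 1 + u <= exp u and gauss_shift give m c <= m^2 / 2 for all
    m, where c is the mean; m = c forces c = 0. *)
Lemma gauss_mean_id : gauss_mean (fun x => x) = 0.
Proof.
set c := gauss_mean _.
have h m : 1 + m * c - m ^+ 2 / 2 <= 1.
  have [i e] := gauss_shift m; rewrite -[leRHS]e.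
  have -> : 1 + m * c - m ^+ 2 / 2 = gauss_mean (fun x => (1 - m ^+ 2 / 2) + m * x).
    rewrite gauss_meanD ?gauss_mean_cst ?gauss_meanZ //; first by rewrite -/c; ring.
    - exact: gauss_integrable_id.
    - exact: gauss_integrable_cst.
    - exact/gauss_integrableZ/gauss_integrable_id.
  apply: gauss_mean_le => //.
    apply: gauss_integrableD; first exact: gauss_integrable_cst.
    exact/gauss_integrableZ/gauss_integrable_id.
  by move=> x; apply: le_trans (expR_ge1Dx _); lra.
have := h c; have := sqr_ge0 c; rewrite -expr2 => c0 h1.
apply/eqP; rewrite -sqrf_eq0 eq_le c0 andbT; lra.
Qed.

(** The inequality 1 + u <= exp u and gauss_quadratic compare the second
    moment with 2 s^2 / (s + 1), from above for s > 1 and from below for s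
    < 1; then s tends to 1. *)
Lemma gauss_mean_sqr : gauss_mean (fun x => x ^+ 2) = 1.
Proof.
set c := gauss_mean _.
have h s : 0 < s -> 1 + (1 - s ^- 2) / 2 * c <= s.
  move=> s0; have [i e] := gauss_quadratic s0; rewrite -[leRHS]e.
  have -> : 1 + (1 - s ^- 2) / 2 * c = gauss_mean (fun x => 1 + (1 - s ^- 2) / 2 * x ^+ 2).
    rewrite gauss_meanD ?gauss_mean_cst ?gauss_meanZ //.
    - exact: gauss_integrable_sqr.
    - exact: gauss_integrable_cst.
    - exact/gauss_integrableZ/gauss_integrable_sqr.
  apply: gauss_mean_le => //.
    apply: gauss_integrableD; first exact: gauss_integrable_cst.
    exact/gauss_integrableZ/gauss_integrable_sqr.
  by move=> x; exact: expR_ge1Dx.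
(* Clearing denominators shows the common factor s - 1, whose sign gives the two bounds. *)
have hs s : 0 < s -> (s - 1) * ((s + 1) * c - 2 * s ^+ 2) <= 0.
  move=> s0; have := h s s0; have s2 : 0 < s ^+ 2 by rewrite exprn_gt0.
  have -> : 1 + (1 - s ^- 2) / 2 * c = s + ((s - 1) * ((s + 1) * c - 2 * s ^+ 2)) / (2 * s ^+ 2).
    by field; rewrite gt_eqF.
  by rewrite gerDl pmulr_lle0 // invr_gt0 mulr_gt0.
apply/eqP; rewrite eq_le; apply/andP; split; apply/ler_addgt0Pr => e e0.
- pose d := Num.min e 1 / 4.
  have d0 : 0 < d by rewrite divr_gt0 // lt_min e0 ltr01.
  have de : d <= e / 4 by rewrite ler_pM2r ?invr_gt0 // ge_min lexx.
  have d1 : d <= 1 / 4 by rewrite ler_pM2r ?invr_gt0 // ge_min lexx orbT.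
  have := hs (1 + d); rewrite addrAC subrr add0r pmulr_rle0 // => /(_ ltac:(lra)) h1.
  nra.
- pose d := Num.min e 1 / 4.
  have d0 : 0 < d by rewrite divr_gt0 // lt_min e0 ltr01.
  have de : d <= e / 4 by rewrite ler_pM2r ?invr_gt0 // ge_min lexx.
  have d1 : d <= 1 / 4 by rewrite ler_pM2r ?invr_gt0 // ge_min lexx orbT.
  have h0 : 0 < 1 - d by lra.
  have := hs (1 - d) h0; rewrite addrAC subrr add0r nmulr_rle0 ?oppr_lt0 // => h1.
  have c0 : 0 <= c by rewrite -(gauss_mean_cst 0); apply: gauss_mean_le => [||x]; [exact: gauss_integrable_cst|exact: gauss_integrable_sqr|exact: sqr_ge0].
  nra.
Qed.

End Gaussian.

(** * Stability of Gaussian averages *)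

Section Stability.
Variable R : realType.
Local Notation leb := (@lebesgue_measure R).
Local Notation phi := (@normal_pdf R 0 1).
Implicit Types f g : R -> R.

Lemma normal_pdf_shift (m s : R) y : 0 < s -> normal_pdf m s (m + s * y) = s^-1 * phi y.
Proof.
move=> s0; have sn0 : s != 0 by rewrite gt_eqF.
rewrite !normal_pdfE ?oner_neq0 // /normal_peak /normal_fun subr0 expr1n mul1r mulrA.
congr (_ * expR _).
  by rewrite -mulrnAr sqrtrM ?sqr_ge0 // sqrtr_sqr (ger0_norm (ltW s0)) invfM.
by field.
Qed.

(** Completing the square: conditioning one coordinate of a Gaussian pair on
    the other gives a Gaussian law again. *)
Lemma normal_pdf_swap (a s x z : R) : 0 < s -> a ^+ 2 + s ^+ 2 = 1 ->
  normal_pdf (a * x) s z * phi x = normal_pdf (a * z) s x * phi z.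
Proof.
move=> s0 as1; have sn0 : s != 0 by rewrite gt_eqF.
rewrite !normal_pdfE ?oner_neq0 // /normal_fun !subr0 expr1n.
rewrite mulrACA [RHS]mulrACA; congr (_ * _); rewrite -!expRD; congr expR.
apply/eqP; rewrite -subr_eq0.
set d := (X in X == 0).
have -> : d = (x ^+ 2 - z ^+ 2) * (1 - (a ^+ 2 + s ^+ 2)) / (2 * s ^+ 2) by rewrite /d; field.
by rewrite as1 subrr mulr0 mul0r.
Qed.

(** Change of variable z = m + s y. *)
Lemma integral_affine f (m s : R) : 0 < s -> continuous f -> (forall x, 0 <= f x) ->
  (\int[leb]_y (f (m + s * y)%R * phi y)%:E)%E = (\int[leb]_z (f z * normal_pdf m s z)%:E)%E.
Proof.
move=> s0 fc f0; have sn0 : s != 0 by rewrite gt_eqF.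
pose F (z : R^o) := (z - m) / s : R^o.
pose G y := f (m + s * y) * phi y.
have F'E : F^`()%classic = cst s^-1.
  apply/funext => x; rewrite /F derive1E deriveM// deriveD// derive_cst scaler0.
  by rewrite add0r derive_id derive_cst addr0 scaler1.
rewrite [LHS](@increasing_ge0_integration_by_substitutionT _ F G).
- apply: eq_integral => z _; rewrite F'E !fctE /= /G /F; congr EFin.
  have zE : m + s * ((z - m) / s) = z by field.
  have := normal_pdf_shift m ((z - m) / s) s0; rewrite zE => ->.
  by rewrite -mulrA [phi _ * _]mulrC.
- by move=> x y xy; rewrite /F ltr_pM2r ?invr_gt0 // ltrD2r.
- by rewrite F'E => ?; exact: cvg_cst.
- by rewrite F'E; exact: is_cvg_cst.
- by rewrite F'E; exact: is_cvg_cst.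
- by [].
- apply/gt0_cvgMlNy; last exact: cvg_addrr_Ny.
  by rewrite invr_gt0.
- apply/gt0_cvgMly; last exact: cvg_addrr.
  by rewrite invr_gt0.
- move=> y; apply: cvgM; last exact: (@continuous_normal_pdf R 0 1 (oner_neq0 _)).
  apply: continuous_comp; last exact: fc.
  by apply: cvgD; [exact: cvg_cst|apply: cvgM; [exact: cvg_cst|exact: cvg_id]].
- by move=> y; rewrite mulr_ge0 // normal_pdf_ge0.
Qed.

Lemma gauss_meanE f : gauss_integrable f ->
  (gauss_mean f)%:E = (\int[leb]_x (f x * phi x)%:E)%E.
Proof. by move=> fi; rewrite /gauss_mean /Rintegral fineK //; exact: integrable_fin_num. Qed.

Lemma measurable_normal_pdf2 (a s : R) : s != 0 ->
  measurable_fun setT (fun p : R * R => normal_pdf (a * p.1) s p.2).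
Proof.
move=> s0; have -> : (fun p : R * R => normal_pdf (a * p.1) s p.2) =
  (fun p => normal_peak s * expR (- (p.2 - a * p.1) ^+ 2 / (s ^+ 2 *+ 2))).
  by apply/funext => p; rewrite normal_pdfE.
apply: measurable_funM => //; apply: measurableT_comp => //.
apply: measurable_funM => //; apply: measurableT_comp => //; apply: measurable_funX.
apply: measurable_funB; first exact: measurable_snd.
by apply: measurable_funM => //; exact: measurable_fst.
Qed.

(** The bounds 0 and 1 give integrability and allow the integral theorems for
    nonnegative functions. *)
Definition bounded_test f := continuous f /\ forall x, 0 <= f x <= 1.

Lemma bounded_test_integrable f : bounded_test f -> gauss_integrable f.
Proof.
move=> [fc f01]; apply: gauss_integrable_le (gauss_integrable_cst 1).
  exact: continuous_measurable_fun.
by move=> x; have /andP[f0 f1] := f01 x; rewrite ger0_norm.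
Qed.

Lemma bounded_test_affine f (a b : R) : bounded_test f -> bounded_test (fun y => f (a + b * y)).
Proof.
move=> [fc f01]; split => // y; apply: continuous_comp; last exact: fc.
by apply: cvgD; [exact: cvg_cst|apply: cvgM; [exact: cvg_cst|exact: cvg_id]].
Qed.

(** The joint density is rewritten by normal_pdf_swap after the Tonelli
    theorem, and the inner integral becomes 1. *)
Lemma gauss_stable f (a s : R) : bounded_test f -> 0 < s -> a ^+ 2 + s ^+ 2 = 1 ->
  gauss_integrable (fun x => gauss_mean (fun y => f (a * x + s * y))) /\
  gauss_mean (fun x => gauss_mean (fun y => f (a * x + s * y))) = gauss_mean f.
Proof.
move=> ft s0 as1; have sn0 : s != 0 by rewrite gt_eqF.
have [fc f01] := ft; have f0 x : 0 <= f x by have /andP[] := f01 x.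
pose g x := gauss_mean (fun y => f (a * x + s * y)).
pose K (p : R * R) : \bar R := (f p.2 * normal_pdf (a * p.1) s p.2)%:E.
have K0 p : (0 <= K p)%E by rewrite lee_fin mulr_ge0 // normal_pdf_ge0.
have mf : measurable_fun setT f by exact: continuous_measurable_fun.
have mK : measurable_fun setT K.
  apply/measurable_EFinP; apply: measurable_funM; last exact: measurable_normal_pdf2.
  by apply: measurableT_comp => //; exact: measurable_snd.
have gE x : (g x)%:E = (\int[leb]_z K (x, z))%E.
  rewrite gauss_meanE; last exact/bounded_test_integrable/bounded_test_affine.
  exact: integral_affine.
have mg : measurable_fun setT g.
  apply/measurable_EFinP; rewrite (_ : EFin \o g = (fun x => \int[leb]_z K (x, z))%E).
    exact: measurable_fun_fubini_tonelli_F.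
  by apply/funext => x; rewrite -gE.
have g01 x : 0 <= g x <= 1.
  have fi := bounded_test_integrable (bounded_test_affine (a * x) s ft).
  apply/andP; split.
    by rewrite -(gauss_mean_cst 0); apply: gauss_mean_le => //; exact: gauss_integrable_cst.
  rewrite -[leRHS](gauss_mean_cst 1); apply: gauss_mean_le => //; first exact: gauss_integrable_cst.
  by move=> y; have /andP[] := f01 (a * x + s * y).
have gi : gauss_integrable g.
  apply: gauss_integrable_le mg _ (gauss_integrable_cst 1) => x.
  by have /andP[g0 g1] := g01 x; rewrite ger0_norm.
split => //; apply: EFin_inj; rewrite gauss_meanE // gauss_meanE; last exact: bounded_test_integrable.
pose H (p : R * R) : \bar R := (f p.2 * normal_pdf (a * p.1) s p.2 * phi p.1)%:E.
have mH : measurable_fun setT H.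
  apply/measurable_EFinP; apply: measurable_funM; first exact/measurable_EFinP.
  by apply: measurableT_comp; [exact: measurable_normal_pdf|exact: measurable_fst].
have H0 p : (0 <= H p)%E by rewrite lee_fin !mulr_ge0 ?normal_pdf_ge0.
transitivity (\int[leb]_x \int[leb]_z H (x, z))%E.
  apply: eq_integral => x _; rewrite EFinM gE.
  have mKx : measurable_fun setT (fun z => K (x, z)).
    apply/measurable_EFinP; apply: measurable_funM; first exact: mf.
    exact: (measurable_normal_pdf (a * x) s).
  rewrite -(@ge0_integralZr _ _ _ leb setT measurableT _ mKx (phi x)%:E).
  - by apply: eq_integral => z _; rewrite -EFinM.
  - by move=> z _; exact: K0.
  - by rewrite lee_fin normal_pdf_ge0.
rewrite [LHS](@fubini_tonelli _ _ _ _ R leb leb H mH H0); apply: eq_integral => z _.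
transitivity (\int[leb]_x ((f z * phi z)%:E * (normal_pdf (a * z) s x)%:E))%E.
  apply: eq_integral => x _; rewrite /H /= -EFinM; congr EFin.
  by rewrite -mulrA normal_pdf_swap // mulrA mulrAC.
have mpdf : measurable_fun setT (fun x => (normal_pdf (a * z) s x)%:E).
  by apply/measurable_EFinP; exact: (measurable_normal_pdf (a * z) s).
rewrite (@ge0_integralZl _ _ _ leb setT measurableT _ mpdf (f z * phi z)%:E).
- by rewrite integral_normal_pdf mule1.
- by move=> x _; rewrite lee_fin normal_pdf_ge0.
- by rewrite lee_fin mulr_ge0 // normal_pdf_ge0.
Qed.

(** Sum of two independent centred Gaussian variables of standard deviations a
    and b. *)
Lemma gauss_convolution f (a b c : R) : bounded_test f -> 0 < b -> 0 < c -> a ^+ 2 + b ^+ 2 = c ^+ 2 ->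
  gauss_integrable (fun x => gauss_mean (fun y => f (a * x + b * y))) /\
  gauss_mean (fun x => gauss_mean (fun y => f (a * x + b * y))) = gauss_mean (fun z => f (c * z)).
Proof.
move=> ft b0 c0 abc; have cn0 : c != 0 by rewrite gt_eqF.
have ft' : bounded_test (fun z => f (c * z)).
  have := bounded_test_affine 0 c ft; congr bounded_test; apply/funext => y; by rewrite add0r.
have e : (a / c) ^+ 2 + (b / c) ^+ 2 = 1.
  by rewrite !expr_div_n -mulrDl abc divff // sqrf_eq0.
have := gauss_stable ft' (divr_gt0 b0 c0) e.
have -> // : (fun x => gauss_mean (fun y => f (c * (a / c * x + b / c * y)))) =
  (fun x => gauss_mean (fun y => f (a * x + b * y))).
apply/funext => x; apply: eq_gauss_mean => y; congr f; by field.
Qed.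

End Stability.

(** * Contraction towards the Gaussian law *)

Section SmoothTests.
Variable R : realType.

(** Test functions with derivatives of order 1, 2, 3 of size s, s^2, s^3,
    without derivatives: a Lipschitz bound and a second-order expansion
    with cubic remainder at each point. The class is stable under
    translation, and rescaling the argument multiplies s. *)
Definition smooth_test (s : R) (f : R -> R) : Prop :=
  [/\ bounded_test f,
      forall x h, `|f (x + h) - f x| <= s * `|h| &
      forall x, exists a b, `|b| <= s ^+ 2 /\
        forall h, `|f (x + h) - f x - a * h - b * h ^+ 2| <= s ^+ 3 * `|h| ^+ 3].

Lemma smooth_test_affine s f (a b : R) : 0 <= b -> smooth_test s f ->
  smooth_test (b * s) (fun y => f (a + b * y)).
Proof.
move=> b0 [fb fl ft]; split; first exact: bounded_test_affine.
  move=> x h; rewrite mulrDr addrA; apply: (le_trans (fl _ _)).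
  by rewrite normrM (ger0_norm b0) mulrCA mulrA.
move=> x; have [u [v [v2 huv]]] := ft (a + b * x).
exists (u * b), (v * b ^+ 2); split.
  by rewrite normrM exprMn mulrC [`|b ^+ 2|]ger0_norm ?sqr_ge0 // ler_wpM2l ?sqr_ge0.
move=> h; have := huv (b * h); rewrite mulrDr addrA normrM (ger0_norm b0).
have -> : u * (b * h) = u * b * h by ring.
have -> : v * (b * h) ^+ 2 = v * b ^+ 2 * h ^+ 2 by ring.
by have -> : s ^+ 3 * (b * `|h|) ^+ 3 = (b * s) ^+ 3 * `|h| ^+ 3 by ring.
Qed.

Lemma smooth_test_shift s f (a : R) : smooth_test s f -> smooth_test s (fun y => f (a + y)).
Proof.
move=> fs; have := smooth_test_affine a ler01 fs; rewrite mul1r.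
by congr smooth_test; apply/funext => y; rewrite mul1r.
Qed.

Lemma gauss_mean_unif (T : finType) (F : T -> R -> R) :
  (forall t, gauss_integrable (F t)) ->
  gauss_integrable (fun y => unif_mean (fun t => F t y)) /\
  gauss_mean (fun y => unif_mean (fun t => F t y)) = unif_mean (fun t => gauss_mean (F t)).
Proof.
move=> Fi; rewrite /unif_mean.
have [h1 h2] : gauss_integrable (fun y => \sum_t F t y) /\
    gauss_mean (fun y => \sum_t F t y) = \sum_t gauss_mean (F t).
  elim: (index_enum T) => [|t r [IH1 IH2]].
    rewrite big_nil (_ : (fun _ => _) = (fun _ => 0)); last by apply/funext => y; rewrite big_nil.
    by split; [exact: gauss_integrable_cst|exact: gauss_mean_cst].
  rewrite big_cons (_ : (fun _ => _) = (fun y => F t y + \sum_(t <- r) F t y)); last first.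
    by apply/funext => y; rewrite big_cons.
  by split; [exact: gauss_integrableD|rewrite gauss_meanD // IH2].
have -> : (fun y => (\sum_t F t y) / #|T|%:R) = (fun y => #|T|%:R^-1 * \sum_t F t y).
  by apply/funext => y; rewrite mulrC.
by split; [exact: gauss_integrableZ|rewrite gauss_meanZ // h2 mulrC].
Qed.

Lemma gauss_mean_lip f (s c : R) : smooth_test s f -> 0 <= s -> 0 <= c ->
  `|f 0 - gauss_mean (fun x => f (c * x))| <= s * c * gauss_mean (fun x => `|x|).
Proof.
move=> [fb fl _] s0 c0; have [fc _] := fb.
have fcb : bounded_test (fun x => f (c * x)).
  by have := bounded_test_affine 0 c fb; congr bounded_test; apply/funext => y; rewrite add0r.
have i0 := bounded_test_integrable fcb; have i1 := gauss_integrable_cst (- f 0).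
have -> : gauss_mean (fun x => f (c * x)) = gauss_mean (fun x => f (c * x) + - f 0) + f 0.
  by rewrite gauss_meanD // gauss_mean_cst subrK.
rewrite opprD addrCA subrr addr0 normrN.
rewrite -gauss_meanZ; last exact: gauss_integrable_norm.
apply: gauss_mean_norm_le.
- apply: measurable_funD => //; apply: continuous_measurable_fun; exact: (proj1 fcb).
- exact/gauss_integrableZ/gauss_integrable_norm.
- move=> x; have := fl 0 (c * x); rewrite add0r normrM (ger0_norm c0); by rewrite mulrA.
Qed.

(** Second-order expansion at 0 under the Gaussian law: the linear term has
    mean zero and the quadratic one gives the variance. *)
Lemma gauss_taylor f (a b c s : R) : bounded_test f -> 0 <= c ->
  (forall h, `|f (0 + h) - f 0 - a * h - b * h ^+ 2| <= s ^+ 3 * `|h| ^+ 3) ->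
  `|gauss_mean (fun x => f (c * x)) - f 0 - b * c ^+ 2| <=
    s ^+ 3 * c ^+ 3 * gauss_mean (fun x => `|x| ^+ 3).
Proof.
move=> fb c0 ft.
have fcb : bounded_test (fun x => f (c * x)).
  by have := bounded_test_affine 0 c fb; congr bounded_test; apply/funext => y; rewrite add0r.
have i0 := bounded_test_integrable fcb.
have i1 := gauss_integrable_cst (- f 0).
have i2 := gauss_integrableZ (- (a * c)) (gauss_integrable_id R).
have i3 := gauss_integrableZ (- (b * c ^+ 2)) (gauss_integrable_sqr R).
have -> : gauss_mean (fun x => f (c * x)) - f 0 - b * c ^+ 2 =
  gauss_mean (fun x => ((f (c * x) + - f 0) + - (a * c) * x) + - (b * c ^+ 2) * x ^+ 2).
  rewrite gauss_meanD //; last by apply: gauss_integrableD => //; exact: gauss_integrableD.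
  rewrite gauss_meanD //; last exact: gauss_integrableD.
  rewrite gauss_meanD // gauss_mean_cst !gauss_meanZ ?gauss_mean_id ?gauss_mean_sqr.
  - by ring.
  - exact: gauss_integrable_sqr.
  - exact: gauss_integrable_id.
rewrite -gauss_meanZ; last exact: gauss_integrable_cube.
apply: gauss_mean_norm_le.
- apply: measurable_funD; last by apply: measurable_funM => //; exact: exprn_measurable.
  apply: measurable_funD; last by apply: measurable_funM => //; exact: measurable_id.
  apply: measurable_funD => //; apply: continuous_measurable_fun; exact: (proj1 fcb).
- exact/gauss_integrableZ/gauss_integrable_cube.
- move=> x; have := ft (c * x); rewrite add0r normrM (ger0_norm c0) !exprMn.
  by rewrite !mulNr !mulrA.
Qed.

End SmoothTests.

Section Contraction.
Variables (R : realType) (k : nat).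
Hypothesis hk : (2 <= k)%N.
Variables (sigma : R).
Hypothesis sigma0 : 0 < sigma.

Local Notation q := (@quarter R).
Local Notation Zb := (@Zbar R k _).
Local Notation v n := (unif_mean (fun t : rrt n => Zb t ^+ 2)).

Definition gauss_at n (f : R -> R) : R := gauss_mean (fun x => f (sigma * q n ^+ 2 * x)).

(** Comparison of the centred index with the Gaussian law of variance sigma^2
    n, up to an error that tends to 0. The cubic scale of the main term is
    what makes the split a contraction; the error may have the lower
    scales 1 and 2. *)
Definition gauss_close (A : R) (err : nat -> R) : Prop :=
  forall n s f, (0 < n)%N -> 0 <= s -> smooth_test s f ->
    `|unif_mean (fun t : rrt n => f (Zb t)) - gauss_at n f| <=
    A * s ^+ 3 * q n ^+ 6 + err n * (s * q n ^+ 2 + s ^+ 2 * q n ^+ 4).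

(** Second-order expansion of both sides: means agree, variances agree
    asymptotically, third absolute moments give the cubic term. *)
Lemma gauss_close_base :
  (exists2 E, 0 <= E & forall n, (0 < n)%N -> `|v n - sigma ^+ 2 * n%:R| <= E * q n ^+ 3) ->
  exists (A : R) (err : nat -> R), [/\ 0 <= A, forall n, 0 <= err n, err @ \oo --> 0 & gauss_close A err].
Proof.
move=> [E E0 HE]; have [M M0 HM] := third_moment R hk.
pose m3 := gauss_mean (fun x : R => `|x| ^+ 3).
have m30 : 0 <= m3.
  rewrite -(gauss_mean_cst 0); apply: gauss_mean_le; [exact: gauss_integrable_cst|exact: gauss_integrable_cube|].
  by move=> x; rewrite exprn_ge0.
have s3 : 0 <= sigma ^+ 3 * m3 by rewrite mulr_ge0 // exprn_ge0 // ltW.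
exists (M + sigma ^+ 3 * m3), (fun n => E / q n); split.
- by rewrite addr_ge0.
- by move=> n; rewrite divr_ge0 // quarter_ge0.
- by rewrite -[0](mulr0 E); apply: cvgMr; exact: cvg_inv_quarter.
move=> n s f n0 s0 [fb fl ft]; have [a [b [b2 hab]]] := ft 0.
have q0 := quarter_gt0 R n0.
have T0 := card_rrt_gt0 n.
have c0 : 0 <= sigma * q n ^+ 2 by rewrite mulr_ge0 ?exprn_ge0 // ltW.
have hg := gauss_taylor fb c0 hab; rewrite -/m3 -/(gauss_at n f) in hg.
have hm : `|unif_mean (fun t : rrt n => f (Zb t)) - f 0 - b * v n| <= s ^+ 3 * (M * q n ^+ 6).
  have -> : unif_mean (fun t : rrt n => f (Zb t)) - f 0 - b * v n =
     unif_mean (fun t : rrt n => f (0 + Zb t) - f 0 - a * Zb t - b * Zb t ^+ 2).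
    rewrite !meanB !meanZ mean_Zbar mean_cst // mulr0 subr0.
    by congr (_ - _ - _); apply: eq_mean => t; rewrite add0r.
  apply: (le_trans (ler_norm_mean _)).
  apply: (@le_trans _ _ (unif_mean (fun t : rrt n => s ^+ 3 * `|Zb t| ^+ 3))).
    by apply: ler_mean => t; exact: hab.
  by rewrite meanZ ler_wpM2l ?exprn_ge0 // HM.
have hv : `|b * (v n - sigma ^+ 2 * n%:R)| <= s ^+ 2 * (E * q n ^+ 3).
  by rewrite normrM ler_pM // HE.
have -> : unif_mean (fun t : rrt n => f (Zb t)) - gauss_at n f =
   (unif_mean (fun t : rrt n => f (Zb t)) - f 0 - b * v n)
   - (gauss_at n f - f 0 - b * (sigma * q n ^+ 2) ^+ 2)
   + b * (v n - sigma ^+ 2 * n%:R).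
  by rewrite -(quarter4 R n); ring.
apply: (le_trans (ler_normD _ _)); apply: (le_trans (lerD (ler_normB _ _) (lexx _))).
have e1 : (M + sigma ^+ 3 * m3) * s ^+ 3 * q n ^+ 6 + E / q n * (s * q n ^+ 2 + s ^+ 2 * q n ^+ 4) =
  s ^+ 3 * (M * q n ^+ 6) + s ^+ 3 * (sigma * q n ^+ 2) ^+ 3 * m3 + s ^+ 2 * (E * q n ^+ 3)
  + E / q n * (s * q n ^+ 2) by field; rewrite gt_eqF.
rewrite [X in _ <= X]e1.
have e2 : 0 <= E / q n * (s * q n ^+ 2).
  by rewrite mulr_ge0 ?divr_ge0 ?mulr_ge0 ?exprn_ge0 // ltW.
lra.
Qed.

(** By 2 sqrt (j n) <= j + n, an average of 2 (j/n)^(3/2) is at most that of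
    j/n + (j/n)^2, that is 1/2 + 1/3 in the limit. *)
Lemma sum_pow6 n : \sum_(1 <= j < n.+1) 2 * q j ^+ 6 <= 5 / 6 * n%:R * q n.+1 ^+ 6.
Proof.
set Q := q n.+1; have Q0 : 0 < Q by exact: quarter_gt0.
rewrite -(ler_pM2l (exprn_gt0 2 Q0)).
have -> : Q ^+ 2 * (5 / 6 * n%:R * Q ^+ 6) = 5 / 6 * n%:R * (Q ^+ 4) ^+ 2 by ring.
rewrite quarter4 mulr_sumr.
apply: (@le_trans _ _ (\sum_(1 <= j < n.+1) (n.+1%:R * j%:R + j%:R ^+ 2))).
  apply: ler_sum_nat => j _; rewrite -(quarter4 R j) -(quarter4 R n.+1) -/Q.
  set x := q j; have := mulr_ge0 (exprn_even_ge0 x (isT : ~~ odd 4)) (sqr_ge0 (x ^+ 2 - Q ^+ 2)).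
  by rewrite -subr_ge0 => h; rewrite -subr_ge0; apply: le_trans h _; rewrite le_eqVlt; apply/orP; left; apply/eqP; ring.
rewrite big_split /= -mulr_sumr.
have -> : \sum_(1 <= j < n.+1) j%:R = n%:R * n.+1%:R / 2 :> R.
  elim: n {Q Q0} => [|n IH]; first by rewrite big_geq // mul0r mul0r.
  by rewrite big_nat_recr //= IH -(natr1 n.+1) -(natr1 n); field.
have := @sum_sqr_prev R n; lra.
Qed.

(** The toll is removed by the Lipschitz bound. Then the two independent parts
    are replaced one after the other by Gaussian variables, the other part
    acting as a translation of the test function; the Gaussian sum is
    recombined by gauss_convolution. *)
Lemma gauss_close_split A err (T : R) n j s f : gauss_close A err ->
  (forall n j, (1 <= j < n)%N -> unif_mean (fun ts : rrt j * rrt (n - j) => `|toll R k ts|) <= T * q n) ->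
  (1 <= j < n)%N -> 0 <= s -> smooth_test s f ->
  `|unif_mean (fun ts : rrt j * rrt (n - j) => f (Zb ts.1 + Zb ts.2 + toll R k ts)) - gauss_at n f| <=
  s * (T * q n) +
  ((A * s ^+ 3 * q j ^+ 6 + err j * (s * q j ^+ 2 + s ^+ 2 * q j ^+ 4)) +
   (A * s ^+ 3 * q (n - j)%N ^+ 6 + err (n - j)%N * (s * q (n - j)%N ^+ 2 + s ^+ 2 * q (n - j)%N ^+ 4))).
Proof.
move=> cl HT jn s0 fs; have [fb fl _] := fs; have /andP[j1 jn'] := jn.
have nj0 : (0 < n - j)%N by rewrite subn_gt0.
have n0 : (0 < n)%N by exact: leq_trans jn'.
set Bj := A * s ^+ 3 * q j ^+ 6 + _; set Bn := A * s ^+ 3 * q (n - j)%N ^+ 6 + _.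
pose m0 := unif_mean (fun ts : rrt j * rrt (n - j) => f (Zb ts.1 + Zb ts.2)).
pose m1 := unif_mean (fun t : rrt j => gauss_at (n - j) (fun y => f (Zb t + y))).
have h0 : `|unif_mean (fun ts : rrt j * rrt (n - j) => f (Zb ts.1 + Zb ts.2 + toll R k ts)) - m0| <= s * (T * q n).
  rewrite -meanB; apply: (le_trans (ler_norm_mean _)).
  apply: (@le_trans _ _ (unif_mean (fun ts : rrt j * rrt (n - j) => s * `|toll R k ts|))).
    by apply: ler_mean => ts; exact: fl.
  by rewrite meanZ ler_wpM2l // HT.
have h1 : `|m0 - m1| <= Bn.
  rewrite /m0 mean_prod -meanB; apply: (le_trans (ler_norm_mean _)).
  rewrite -[leRHS](mean_cst (card_rrt_gt0 j)); apply: ler_mean => t.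
  exact: (cl _ _ _ nj0 s0 (smooth_test_shift (Zb t) fs)).
have h2 : `|m1 - gauss_at n f| <= Bj.
  pose c := sigma * q j ^+ 2; pose c' := sigma * q (n - j)%N ^+ 2.
  have c0 : 0 < c by rewrite mulr_gt0 // exprn_gt0 // quarter_gt0.
  have cn0 : 0 < sigma * q n ^+ 2 by rewrite mulr_gt0 // exprn_gt0 // quarter_gt0.
  have cc : c' ^+ 2 + c ^+ 2 = (sigma * q n ^+ 2) ^+ 2.
    have qq : q (n - j)%N ^+ 4 + q j ^+ 4 = q n ^+ 4.
      by rewrite !quarter4 -natrD subnK // ltnW.
    have -> : (sigma * q n ^+ 2) ^+ 2 = sigma ^+ 2 * q n ^+ 4 by ring.
    by rewrite -qq /c /c'; ring.
  have [gi ge] := gauss_convolution fb c0 cn0 cc.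
  have ti t : gauss_integrable (fun y => f (@Zbar R k j t + c' * y)).
    exact/bounded_test_integrable/bounded_test_affine.
  have [ui ue] := gauss_mean_unif ti.
  rewrite /m1 /gauss_at -ue -ge -[X in _ - X]mul1r -mulNr -gauss_meanZ // -gauss_meanD //; last exact: gauss_integrableZ.
  rewrite -[leRHS]gauss_mean_cst.
  have bnd y : `|unif_mean (fun t : rrt j => f (Zb t + c' * y)) + -1 * gauss_mean (fun x => f (c' * y + c * x))| <= Bj.
    have := cl _ _ _ j1 s0 (smooth_test_shift (c' * y) fs); rewrite mulN1r.
    congr (`|_ - _| <= _); apply: eq_mean => t; by rewrite addrC.
  have di : gauss_integrable (fun y => unif_mean (fun t : rrt j => f (Zb t + c' * y)) + -1 * gauss_mean (fun x => f (c' * y + c * x))).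
    by apply: gauss_integrableD => //; exact: gauss_integrableZ.
  rewrite ler_norml; apply/andP; split.
    rewrite -(mulN1r (gauss_mean (fun=> Bj))) -gauss_meanZ; last exact: gauss_integrable_cst.
    apply: gauss_mean_le => //; first exact/gauss_integrableZ/gauss_integrable_cst.
    by move=> y; have := bnd y; rewrite ler_norml => /andP[+ _]; rewrite -[X in X <= _ -> _]mulN1r.
  apply: gauss_mean_le => //; first exact: gauss_integrable_cst.
  by move=> y; exact: le_trans (ler_norm _) (bnd y).
set u := unif_mean _ in h0 *.
have -> : u - gauss_at n f = (u - m0) + ((m1 - gauss_at n f) + (m0 - m1)) by ring.
by apply: (le_trans (ler_normD _ _)); rewrite lerD // (le_trans (ler_normD _ _)) // lerD.
Qed.

(** Averaging gauss_close_split over j: the constant A is multiplied by 5/6 by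
    sum_pow6, while the error is averaged, which preserves its convergence
    to 0. *)
Lemma gauss_close_step (A : R) (err : nat -> R) : 0 <= A -> (forall n, 0 <= err n) -> err @ \oo --> 0 -> gauss_close A err ->
  exists err' : nat -> R, [/\ forall n, 0 <= err' n, err' @ \oo --> 0 & gauss_close (5 / 6 * A) err'].
Proof.
move=> A0 e0 ecv cl; have [T T0 HT] := toll_mean R hk.
pose m1 := gauss_mean (fun x : R => `|x|).
have m10 : 0 <= m1.
  rewrite -(gauss_mean_cst 0); apply: gauss_mean_le => //; [exact: gauss_integrable_cst|exact: gauss_integrable_norm].
pose avg n := (\sum_(1 <= j < n) err j) / n.-1%:R.
have avg0 n : 0 <= avg n by rewrite divr_ge0 // sumr_ge0.
(* For n = 1 the index is constant; the Lipschitz bound alone gives the scale s. *)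
pose err' n := if (n <= 1)%N then sigma * m1 else 2 * avg n + T / q n.
exists err'; split.
- move=> n; rewrite /err'; case: ifP => _; first by rewrite mulr_ge0 // ltW.
  by apply: addr_ge0; [exact: mulr_ge0|rewrite divr_ge0 ?quarter_ge0].
- have h : 2 * avg n + T / q n @[n --> \oo] --> (0 : R).
    rewrite -[X in _ --> X]addr0; apply: cvgD.
      by rewrite -(mulr0 2); apply: cvgMr; exact: cvg_average.
    by rewrite -(mulr0 T); apply: cvgMr; exact: cvg_inv_quarter.
  apply: cvg_trans h; apply: near_eq_cvg; near=> n.
  rewrite /err' leqNgt; have -> // : (1 < n)%N by near: n; exact: nbhs_infty_gt.
move=> n s f n0 s0 fs.
have [n1|n2] := leqP n 1.
  have -> : n = 1%N by apply/eqP; rewrite eqn_leq n1 n0.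
  rewrite /err' leqnn (eq_mean (g := fun _ : rrt 1 => f 0)); last by move=> t; rewrite Zbar_size1.
  rewrite mean_cst ?card_rrt_gt0 // /gauss_at.
  have -> : q 1 = 1 by rewrite /quarter !sqrtr1.
  rewrite !expr1n !mulr1; apply: (le_trans (gauss_mean_lip fs s0 (ltW sigma0))).
  have h1 : 0 <= 5 / 6 * A * s ^+ 3 by rewrite mulr_ge0 ?exprn_ge0 // mulr_ge0 //; lra.
  have h2 : 0 <= sigma * m1 * s ^+ 2 by rewrite !mulr_ge0 ?sqr_ge0 // ltW.
  rewrite -/m1 mulrDr; have -> : s * sigma * m1 = sigma * m1 * s by ring.
  lra.
rewrite /err' leqNgt n2 /=.
rewrite (mean_split_bar k f n2).
have q0 := quarter_gt0 R n0.
set D := s * q n ^+ 2 + s ^+ 2 * q n ^+ 4.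
have n1R : 0 < n.-1%:R :> R by rewrite ltr0n -subn1 subn_gt0.
have -> : gauss_at n f = (\sum_(1 <= j < n) gauss_at n f) / n.-1%:R.
  by rewrite sumr_const_nat subn1 -(mulr_natr (gauss_at n f)) mulfK // gt_eqF.
rewrite -mulrBl -sumrB normrM [`|_^-1|]ger0_norm ?invr_ge0 ?(ltW n1R) //.
rewrite ler_pdivrMr //; apply: (le_trans (ler_norm_sum _ _ _)).
pose B j := A * s ^+ 3 * q j ^+ 6 + err j * D.
have BB j : (j <= n)%N ->
   A * s ^+ 3 * q j ^+ 6 + err j * (s * q j ^+ 2 + s ^+ 2 * q j ^+ 4) <= B j.
  move=> jn; rewrite /B lerD2l; apply: ler_wpM2l => //.
  have qq := ler_quarter R jn.
  by apply: lerD; [apply: ler_wpM2l => //|apply: ler_wpM2l; rewrite ?sqr_ge0 //]; rewrite lerXn2r ?nnegrE ?quarter_ge0.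
apply: (@le_trans _ _ (\sum_(1 <= j < n) (s * (T * q n) + (B j + B (n - j)%N)))).
  apply: ler_sum_nat => j jn; apply: (le_trans (gauss_close_split cl HT jn s0 fs)).
  have /andP[j1 jn'] := jn.
  by rewrite lerD2l lerD // BB // ?leq_subr // ltnW.
rewrite big_split /= big_split /= (sum_prev_rev B) sumr_const_nat subn1 -(mulr_natr (s * _)).
have SB : \sum_(1 <= j < n) B j + \sum_(1 <= j < n) B j =
   A * s ^+ 3 * (\sum_(1 <= j < n) 2 * q j ^+ 6) + 2 * avg n * D * n.-1%:R.
  rewrite /B big_split /= -!mulr_sumr -mulr_suml /avg.
  by field; rewrite gt_eqF.
rewrite SB.
have h6 : A * s ^+ 3 * (\sum_(1 <= j < n) 2 * q j ^+ 6) <= A * s ^+ 3 * (5 / 6 * n.-1%:R * q n ^+ 6).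
  apply: ler_wpM2l; first by rewrite mulr_ge0 // exprn_ge0.
  by have := sum_pow6 n.-1; rewrite prednK.
have hT : s * (T * q n) <= T / q n * D.
  have -> : s * (T * q n) = T / q n * (s * q n ^+ 2) by field; rewrite gt_eqF.
  apply: ler_wpM2l; first by rewrite divr_ge0 // ltW.
  by rewrite lerDl mulr_ge0 ?sqr_ge0 // exprn_ge0 // ltW.
have hT' : s * (T * q n) * n.-1%:R <= T / q n * D * n.-1%:R by rewrite ler_wpM2r // ltW.
rewrite mulrDl; lra.
Unshelve. all: by end_near. Qed.

(** Iteration of gauss_close_step. *)
Lemma gauss_close_small :
  (exists2 E, 0 <= E & forall n, (0 < n)%N -> `|v n - sigma ^+ 2 * n%:R| <= E * q n ^+ 3) ->
  forall eps, 0 < eps -> exists (A : R) (err : nat -> R), [/\ 0 <= A, A <= eps, err @ \oo --> 0 & gauss_close A err].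
Proof.
move=> HE eps eps0; have [A [err [A0 e0 ecv cl]]] := gauss_close_base HE.
have iter m : exists err : nat -> R, [/\ forall n, 0 <= err n, err @ \oo --> 0 & gauss_close ((5 / 6) ^+ m * A) err].
  elim: m => [|m [err' [e0' ecv' cl']]]; first by exists err; rewrite expr0 mul1r.
  have [|err2 [? ? h]] := gauss_close_step _ e0' ecv' cl'; first by rewrite mulr_ge0 // exprn_ge0.
  by exists err2; rewrite exprS -mulrA.
have h : (5 / 6) ^+ m * A @[m --> \oo] --> (0 : R).
  rewrite -(mul0r A); apply: cvgMl; apply: cvg_expr.
  by rewrite ger0_norm //; lra.
have [m hm] : exists m, (5 / 6) ^+ m * A <= eps.
  by near \oo => m; exists m; near: m; exact: (cvgr_le _ h).
have [err' [_ ecv' cl']] := iter m; exists ((5 / 6) ^+ m * A), err'; split => //.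
by rewrite mulr_ge0 // exprn_ge0.
Unshelve. all: by end_near. Qed.

End Contraction.

(** * From smooth test functions to distribution functions *)

Section SmoothStep.
Variable R : realType.

Definition pospart (x : R) : R := Num.max x 0.

(** One minus the primitive of the quadratic B-spline with knots 0, 1, 2, 3: a
    step that decreases from 1 to 0 with a Lipschitz second derivative. *)
Definition cubic_step (x : R) : R :=
  1 - (pospart x ^+ 3 - 3 * pospart (x - 1) ^+ 3 + 3 * pospart (x - 2) ^+ 3 - pospart (x - 3) ^+ 3) / 6.

Lemma pospart_pos x : 0 <= x -> pospart x = x.
Proof. by move=> x0; rewrite /pospart; apply/max_idPl. Qed.

Lemma pospart_neg x : x <= 0 -> pospart x = 0.
Proof. by move=> x0; rewrite /pospart; apply/max_idPr. Qed.

(** For x and x + h both positive the remainder is h^3 exactly; a change of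
    sign only truncates it. *)
Lemma pospart_taylor (x h : R) :
  `|pospart (x + h) ^+ 3 - pospart x ^+ 3 - 3 * pospart x ^+ 2 * h - 3 * pospart x * h ^+ 2| <= `|h| ^+ 3.
Proof.
rewrite -normrX; have [x0|x0] := leP 0 x; have [y0|y0] := leP 0 (x + h).
- rewrite !pospart_pos //; rewrite (_ : _ - _ = h ^+ 3) //; ring.
- rewrite (pospart_pos x0) (pospart_neg (ltW y0)).
  have -> : 0 ^+ 3 - x ^+ 3 - 3 * x ^+ 2 * h - 3 * x * h ^+ 2 = h ^+ 3 - (x + h) ^+ 3 by ring.
  have h0 : h <= x + h by rewrite lerDr.
  have e : 0 <= (- (x + h)) ^+ 3 by rewrite exprn_ge0 // oppr_ge0 ltW.
  have e2 : (- (x + h)) ^+ 3 <= (- h) ^+ 3 by rewrite lerXn2r ?nnegrE ?oppr_ge0 ?lerN2 //; lra.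
  have n1 : (- (x + h)) ^+ 3 = - (x + h) ^+ 3 by ring.
  have n2 : (- h) ^+ 3 = - h ^+ 3 by ring.
  rewrite n1 in e e2; rewrite n2 in e2.
  by rewrite !ler0_norm; lra.
- rewrite (pospart_neg (ltW x0)) (pospart_pos y0).
  have -> : (x + h) ^+ 3 - 0 ^+ 3 - 3 * 0 ^+ 2 * h - 3 * 0 * h ^+ 2 = (x + h) ^+ 3 by ring.
  have e : 0 <= (x + h) ^+ 3 by rewrite exprn_ge0.
  have e2 : (x + h) ^+ 3 <= h ^+ 3 by rewrite lerXn2r ?nnegrE //; lra.
  by rewrite !ger0_norm //; lra.
- rewrite (pospart_neg (ltW x0)) (pospart_neg (ltW y0)).
  by rewrite (_ : _ - _ = 0) ?normr0 //; ring.
Qed.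

(** The position of x among the knots, with the resulting values of the four
    positive parts. *)
Variant knot_spec (x : R) : R -> R -> R -> R -> Type :=
| Knot0 of x <= 0 : knot_spec x 0 0 0 0
| Knot1 of 0 <= x <= 1 : knot_spec x x 0 0 0
| Knot2 of 1 <= x <= 2 : knot_spec x x (x - 1) 0 0
| Knot3 of 2 <= x <= 3 : knot_spec x x (x - 1) (x - 2) 0
| Knot4 of 3 <= x : knot_spec x x (x - 1) (x - 2) (x - 3).

Lemma knotP x : knot_spec x (pospart x) (pospart (x - 1)) (pospart (x - 2)) (pospart (x - 3)).
Proof.
have [h0|/ltW h0] := leP x 0; first by rewrite !pospart_neg; [constructor| lra..].
have [h1|/ltW h1] := leP x 1.
  by rewrite pospart_pos // !pospart_neg; [constructor; rewrite h0| lra..].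
have [h2|/ltW h2] := leP x 2.
  by rewrite !(pospart_pos h0) (@pospart_pos (x - 1)) ?(@pospart_neg (x - 2)) ?(@pospart_neg (x - 3)); [constructor; rewrite h1| lra..].
have [h3|/ltW h3] := leP x 3.
  by rewrite !(pospart_pos h0) (@pospart_pos (x - 1)) ?(@pospart_pos (x - 2)) ?(@pospart_neg (x - 3)); [constructor; rewrite h2| lra..].
by rewrite !(pospart_pos h0) (@pospart_pos (x - 1)) ?(@pospart_pos (x - 2)) ?(@pospart_pos (x - 3)); [constructor| lra..].
Qed.

Lemma cubic_step01 x : 0 <= cubic_step x <= 1.
Proof.
have unit_powers (y : R) : 0 <= y <= 1 -> [/\ 0 <= y ^+ 2, y ^+ 2 <= y, 0 <= y ^+ 3 & y ^+ 3 <= y ^+ 2].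
  move=> /andP[y0 y1]; rewrite !exprn_ge0 //; split=> //.
    by rewrite expr2 ler_piMl.
  by rewrite [leLHS]exprS ler_piMl // exprn_ge0.
rewrite /cubic_step; case: knotP => [h|h|h|h|h].
- by rewrite expr0n /=; lra.
- have [p1 p2 p3 p4] := unit_powers x h; rewrite expr0n /=; move/andP: h => [h1 h2]; lra.
- have h' : 0 <= x - 1 <= 1 by lra.
  have [p1 p2 p3 p4] := unit_powers _ h'; move: p1 p2 p3 p4 h'.
  have -> : x ^+ 3 = (x - 1 + 1) ^+ 3 by rewrite subrK.
  move: (x - 1) => y p1 p2 p3 p4 h'; rewrite expr0n /=.
  have -> : (y + 1) ^+ 3 = y ^+ 3 + 3 * y ^+ 2 + 3 * y + 1 by ring.
  (* On the middle piece the linear bounds on y, y^2, y^3 are too weak by themselves. *)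
  have p5 : 0 <= y * (y - 1) ^+ 2 by rewrite mulr_ge0 ?sqr_ge0; lra.
  have : 0 <= y ^+ 3 - 2 * y ^+ 2 + y by apply: le_trans p5 _; rewrite le_eqVlt; apply/orP; left; apply/eqP; ring.
  lra.
- have h' : 0 <= 3 - x <= 1 by lra.
  have [p1 p2 p3 p4] := unit_powers _ h'; rewrite expr0n /=.
  have -> : 1 - (x ^+ 3 - 3 * (x - 1) ^+ 3 + 3 * (x - 2) ^+ 3 - 0) / 6 = (3 - x) ^+ 3 / 6 by field.
  lra.
- have -> : 1 - (x ^+ 3 - 3 * (x - 1) ^+ 3 + 3 * (x - 2) ^+ 3 - (x - 3) ^+ 3) / 6 = 0 by field.
  lra.
Qed.

Lemma cubic_step_left x : x <= 0 -> cubic_step x = 1.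
Proof. by move=> x0; rewrite /cubic_step !pospart_neg; try lra; field. Qed.

Lemma cubic_step_right x : 3 <= x -> cubic_step x = 0.
Proof. by move=> x0; rewrite /cubic_step !pospart_pos; try lra; field. Qed.

Lemma lipschitz_continuous (f : R -> R) (c : R) : 0 < c ->
  (forall x h, `|f (x + h) - f x| <= c * `|h|) -> continuous f.
Proof.
move=> c0 fl x; apply/cvgrPdist_le => e e0.
near=> y; rewrite distrC.
have -> : f y = f (x + (y - x)) by rewrite addrC subrK.
apply: (le_trans (fl _ _)).
rewrite mulrC -ler_pdivlMr // distrC.
by near: y; apply: (@cvgr_dist_le _ _ _ _ _ (fun y => y)) => //; rewrite divr_gt0.
Unshelve. all: by end_near. Qed.

(** Coefficients of the expansion are bounded, so the Lipschitz bound follows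
    from the expansion for small h and from the bounds 0 and 1 for large
    h. *)
Lemma smooth_cubic_step : smooth_test 4 cubic_step.
Proof.
have taylor x : exists a b, [/\ `|a| <= 1, `|b| <= 1 &
    forall h, `|cubic_step (x + h) - cubic_step x - a * h - b * h ^+ 2| <= 4 / 3 * `|h| ^+ 3].
  exists (- (pospart x ^+ 2 - 3 * pospart (x - 1) ^+ 2 + 3 * pospart (x - 2) ^+ 2 - pospart (x - 3) ^+ 2) / 2).
  exists (- (pospart x - 3 * pospart (x - 1) + 3 * pospart (x - 2) - pospart (x - 3)) / 2).
  split.
  - by rewrite ler_norml; case: knotP => [h|/andP[h1 h2]|/andP[h1 h2]|/andP[h1 h2]|h]; apply/andP; split; nra.
  - by rewrite ler_norml; case: knotP => [h|/andP[h1 h2]|/andP[h1 h2]|/andP[h1 h2]|h]; apply/andP; split; lra.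
  move=> h; have := pospart_taylor x h; have := pospart_taylor (x - 1) h.
  have := pospart_taylor (x - 2) h; have := pospart_taylor (x - 3) h.
  rewrite /cubic_step; have E (c : R) : x - c + h = x + h - c by ring.
  rewrite !E !ler_norml => /andP[a1 a2] /andP[b1 b2] /andP[c1 c2] /andP[d1 d2].
  by apply/andP; split; lra.
have lip x h : `|cubic_step (x + h) - cubic_step x| <= 4 * `|h|.
  have [h1|h1] := leP `|h| 1.
    have [a [b [a1 b1 /(_ h) hab]]] := taylor x.
    have -> : cubic_step (x + h) - cubic_step x =
      (cubic_step (x + h) - cubic_step x - a * h - b * h ^+ 2) + (a * h + b * h ^+ 2) by ring.
    apply: (le_trans (ler_normD _ _)); apply: (le_trans (lerD hab (ler_normD _ _))).
    rewrite (normrM a) (normrM b) normrX; set y := `|h| in h1 *; have y0 : 0 <= y by exact: normr_ge0.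
    have e1 : y ^+ 3 <= y by rewrite -[leRHS]expr1 ler_wiXn2l.
    have e2 : `|b| * y ^+ 2 <= y.
      have y2 : y ^+ 2 <= y by rewrite -[leRHS]expr1 ler_wiXn2l.
      by apply: le_trans y2; rewrite ler_piMl ?sqr_ge0.
    have e3 : `|a| * y <= y by rewrite ler_piMl.
    lra.
  have /andP[u0 u1] := cubic_step01 (x + h); have /andP[w0 w1] := cubic_step01 x.
  by apply: (@le_trans _ _ 1); [rewrite ler_norml; apply/andP; split|]; lra.
split => //.
- split; last exact: cubic_step01.
  by apply: (@lipschitz_continuous _ 4).
- move=> x; have [a [b [a1 b1 hab]]] := taylor x; exists a, b; split; first by lra.
  move=> h; apply: (le_trans (hab h)); rewrite ler_wpM2r ?exprn_ge0 //; lra.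
Qed.

Lemma smooth_indicator (x eps : R) : 0 < eps -> exists s f, [/\ 0 < s, smooth_test s f,
  forall y, y <= x -> f y = 1 & forall y, x + eps <= y -> f y = 0].
Proof.
move=> e0; have b0 : 0 < 3 / eps by rewrite divr_gt0.
exists (3 / eps * 4), (fun y => cubic_step (- (3 / eps * x) + 3 / eps * y)); split.
- by rewrite mulr_gt0.
- exact: smooth_test_affine (ltW b0) smooth_cubic_step.
- move=> y yx; apply: cubic_step_left; rewrite addrC subr_le0 ler_pM2l //.
- move=> y yx; apply: cubic_step_right; rewrite addrC -mulrBr.
  rewrite mulrAC ler_pdivlMr // ler_pM2l //; lra.
Qed.

End SmoothStep.

Section Limit.
Variables (R : realType) (k : nat).
Hypothesis hk : (2 <= k)%N.

Local Notation q := (@quarter R).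
Local Notation Zb := (@Zbar R k _).
Local Notation v n := (unif_mean (fun t : rrt n => Zb t ^+ 2)).

Definition normalized (muk sigma : R) n (t : rrt n) : R :=
  ((Z k t)%:R - muk * n%:R) / (sigma * Num.sqrt n%:R).

(** The normalization divides s by a quantity of order sqrt n, which
    compensates the scales in gauss_close; replacing the mean by mu_k n
    shifts the argument by O(n^(-1/4)). *)
Lemma cvg_smooth_mean (muk sigma D E s : R) (f : R -> R) :
  0 < sigma -> 0 <= D -> 0 <= E -> 0 < s -> smooth_test s f ->
  (forall n, (0 < n)%N -> `|mu R k n - muk * n%:R| <= D * q n) ->
  (forall n, (0 < n)%N -> `|v n - sigma ^+ 2 * n%:R| <= E * q n ^+ 3) ->
  unif_mean (fun t : rrt n => f (normalized muk sigma t)) @[n --> \oo] --> gauss_mean f.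
Proof.
move=> sg0 D0 E0 s0 fs Hmu Hv; have [fb fl _] := fs.
apply/cvgrPdist_le => eta eta0.
pose eps := eta / 3 / (s / sigma) ^+ 3.
have ss0 : 0 < s / sigma by rewrite divr_gt0.
have eps0 : 0 < eps by rewrite !divr_gt0 // exprn_gt0.
have [A [err [A0 Aeps ecv cl]]] := gauss_close_small hk sg0 (ex_intro2 _ _ E E0 Hv) eps0.
pose L := s / sigma + (s / sigma) ^+ 2.
have L0 : 0 < L by rewrite addr_gt0 // exprn_gt0.
have hL : err n * L @[n --> \oo] --> (0 : R).
  by rewrite -(mul0r L); apply: cvgMl.
have hD : s * D / sigma / q n @[n --> \oo] --> (0 : R).
  by rewrite -(mulr0 (s * D / sigma)); apply: cvgMr; exact: cvg_inv_quarter.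
have eta3 : 0 < eta / 3 by rewrite divr_gt0.
near=> n.
have n0 : (0 < n)%N by near: n; exact: nbhs_infty_gt.
have q0 := quarter_gt0 R n0.
have e1 : err n * L <= eta / 3 by near: n; exact: (cvgr_le _ hL).
have e2 : s * D / sigma / q n <= eta / 3 by near: n; exact: (cvgr_le _ hD).
pose be := (sigma * q n ^+ 2)^-1; pose de := (mu R k n - muk * n%:R) * be.
have be0 : 0 < be by rewrite invr_gt0 mulr_gt0 // exprn_gt0.
have fE : unif_mean (fun t : rrt n => f (normalized muk sigma t)) =
          unif_mean (fun t : rrt n => f (de + be * Zb t)).
  apply: eq_mean => t; congr f; rewrite /normalized /de /be -quarter2 /Zbar; by ring.
rewrite fE.
have h1 := cl n _ _ n0 (ltW (mulr_gt0 be0 s0)) (smooth_test_affine de (ltW be0) fs).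
have gE : gauss_at sigma n (fun y => f (de + be * y)) = gauss_mean (fun x => f (de + x)).
  apply: eq_gauss_mean => x; congr f; rewrite /be; congr (_ + _); field.
  by rewrite !gt_eqF.
rewrite gE in h1.
have i1 := bounded_test_integrable fb.
have i2 : gauss_integrable (fun x => f (de + x)).
  by have [? _ _] := smooth_test_shift de fs; exact: bounded_test_integrable.
have h2 : `|gauss_mean (fun x => f (de + x)) - gauss_mean f| <= s * `|de|.
  have -> : gauss_mean (fun x => f (de + x)) - gauss_mean f = gauss_mean (fun x => f (de + x) + -1 * f x).
    rewrite gauss_meanD //; last exact: gauss_integrableZ.
    by rewrite gauss_meanZ // mulN1r.
  rewrite -[leRHS]gauss_mean_cst; apply: gauss_mean_norm_le; last 2 first.
  - exact: gauss_integrable_cst.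
  - by move=> x; rewrite mulN1r addrC; have := fl x de; rewrite [_ - f x]addrC [x + de]addrC.
  have [[fc _] _ _] := smooth_test_shift de fs.
  apply: measurable_funD; first exact: continuous_measurable_fun.
  by apply: measurable_funM => //; apply: continuous_measurable_fun; exact: (proj1 fb).
have h3 : s * `|de| <= s * D / sigma / q n.
  have -> : s * D / sigma / q n = s * (D * q n * be) by rewrite /be; field; rewrite !gt_eqF.
  by rewrite ler_wpM2l ?(ltW s0) // normrM (gtr0_norm be0) ler_wpM2r ?(ltW be0) // Hmu.
have h4 : A * (be * s) ^+ 3 * q n ^+ 6 + err n * (be * s * q n ^+ 2 + (be * s) ^+ 2 * q n ^+ 4) =
   A * (s / sigma) ^+ 3 + err n * L.
  by rewrite /be /L; field; rewrite !gt_eqF.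
have h5 : A * (s / sigma) ^+ 3 <= eta / 3.
  by rewrite -ler_pdivlMr ?exprn_gt0.
rewrite h4 in h1.
rewrite distrC.
have -> : unif_mean (fun t : rrt n => f (de + be * Zb t)) - gauss_mean f =
  (unif_mean (fun t : rrt n => f (de + be * Zb t)) - gauss_mean (fun x => f (de + x)))
  + (gauss_mean (fun x => f (de + x)) - gauss_mean f) by ring.
apply: (le_trans (ler_normD _ _)); lra.
Unshelve. all: by end_near. Qed.

Lemma unif_prob_mean (T : finType) (P : pred T) :
  unif_prob R P = unif_mean (fun t => (P t)%:R).
Proof.
by rewrite /unif_prob /unif_mean -sum1_card natr_sum big_mkcond; congr (_ / _); apply: eq_bigr => t _; rewrite unfold_in; case: (P t).
Qed.

Definition gauss_cdf (x : R) : R := fine (normal_prob 0 1 [set` `]-oo, x]]).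

Lemma gauss_cdfE (x : R) :
  gauss_integrable (fun y : R => (y <= x)%R%:R) /\ gauss_mean (fun y => (y <= x)%R%:R) = gauss_cdf x.
Proof.
have E : (fun y : R => (y <= x)%R%:R) = \1_(`]-oo, x]%classic) :> (R -> R).
  by apply/funext => y; rewrite indicE mem_setE in_itv.
split.
  apply: gauss_integrable_le (gauss_integrable_cst 1); first by rewrite E; exact: measurable_indic.
  by move=> y; case: (y <= x); rewrite ?normr1 ?normr0.
rewrite /gauss_cdf /normal_prob integral_mkcond /gauss_mean /Rintegral; congr fine.
apply: eq_integral => y _; rewrite patchE mem_setE in_itv /=.
by case: (y <= x); rewrite ?mul1r ?mul0r.
Qed.

(** Indicators of half-lines are squeezed between smooth steps of width eps on
    both sides, and the limits compare by continuity of the limit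
    distribution function at x. *)
Lemma zagreb_clt (muk sigma D E : R) :
  0 < sigma -> 0 <= D -> 0 <= E ->
  (forall n, (0 < n)%N -> `|mu R k n - muk * n%:R| <= D * q n) ->
  (forall n, (0 < n)%N -> `|v n - sigma ^+ 2 * n%:R| <= E * q n ^+ 3) ->
  cvg_in_distribution (fun n (t : rrt n) => normalized muk sigma t) (normal_prob 0 1).
Proof.
move=> sg0 D0 E0 Hmu Hv x cx; rewrite -/(gauss_cdf x) in cx *.
apply/cvgrPdist_le => eta eta0.
have eta2 : 0 < eta / 2 by rewrite divr_gt0.
have /cvgrPdist_le/(_ _ eta2) := cx; rewrite near_nbhs => /nbhs_normP[d /= d0 hd].
pose e := d / 2; have e0 : 0 < e by rewrite divr_gt0.
have cdfe y : `|y - x| <= e -> `|gauss_cdf x - gauss_cdf y| <= eta / 2.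
  by move=> yx; apply: hd => /=; rewrite distrC; apply: (le_lt_trans yx); rewrite /e; lra.
have [s [f [s0 fs f1 f2]]] := smooth_indicator x e0.
have [s' [g [s'0 gs g1 g2]]] := smooth_indicator (x - e) e0.
have cf := cvg_smooth_mean sg0 D0 E0 s0 fs Hmu Hv.
have cg := cvg_smooth_mean sg0 D0 E0 s'0 gs Hmu Hv.
have [fb _ _] := fs; have [gb _ _] := gs.
have fle : gauss_mean f <= gauss_cdf (x + e).
  have [i <-] := gauss_cdfE (x + e); apply: gauss_mean_le => //; first exact: bounded_test_integrable.
  move=> y; have [_ /(_ y)/andP[_ fy]] := fb; have [//|/ltW yx] := leP y (x + e).
  by rewrite f2.
have gle : gauss_cdf (x - e) <= gauss_mean g.
  have [i <-] := gauss_cdfE (x - e); apply: gauss_mean_le => //; first exact: bounded_test_integrable.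
  move=> y; have [_ /(_ y)/andP[gy _]] := gb; have [yx|//] := leP y (x - e).
  by rewrite g1.
have hx1 := cdfe (x + e); rewrite addrAC subrr add0r ger0_norm ?(ltW e0) // in hx1.
have hx2 := cdfe (x - e); rewrite addrAC subrr add0r normrN ger0_norm ?(ltW e0) // in hx2.
have {hx1} := hx1 (lexx _); rewrite ler_norml => /andP[u1 _].
have {hx2} := hx2 (lexx _); rewrite ler_norml => /andP[_ u2].
near=> n.
have nf : `|gauss_mean f - unif_mean (fun t : rrt n => f (normalized muk sigma t))| <= eta / 2.
  by near: n; move/cvgrPdist_le : cf; apply.
have ng : `|gauss_mean g - unif_mean (fun t : rrt n => g (normalized muk sigma t))| <= eta / 2.
  by near: n; move/cvgrPdist_le : cg; apply.
rewrite unif_prob_mean; set P := unif_mean _.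
have Pf : P <= unif_mean (fun t : rrt n => f (normalized muk sigma t)).
  apply: ler_mean => t; set y := normalized _ _ _; have [_ /(_ y)/andP[fy _]] := fb.
  by have [yx|//] := leP y x; rewrite f1.
have Pg : unif_mean (fun t : rrt n => g (normalized muk sigma t)) <= P.
  apply: ler_mean => t; set y := normalized _ _ _; have [_ /(_ y)/andP[_ gy]] := gb.
  by have [yx//|yx] := leP y x; rewrite g2 // subrK ltW.
move: nf ng; rewrite !ler_norml => /andP[a1 a2] /andP[b1 b2].
by apply/andP; split; lra.
Unshelve. all: by end_near. Qed.

End Limit.

Unset Implicit Arguments.

Theorem theorem3p1 (R : realType) (k : nat) (hk : (2 <= k)%N) :
  exists mu_k sigma_k : R,
    [/\ 0 < mu_k,
        0 < sigma_k,
        (fun n : nat => 2 * \sum_(2 <= j < n) b R k j / (j * j.+1)%:R) @ \oo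
          --> mu_k,
        (fun n : nat => 2 * \sum_(2 <= j < n) beta R k j / (j * j.+1)%:R) @ \oo
          --> sigma_k ^+ 2 &
        cvg_in_distribution
          (fun (n : nat) (t : rrt n) =>
             ((Z k t)%:R - mu_k * n%:R) / (sigma_k * Num.sqrt n%:R))
          (normal_prob 0 1)].
Proof.
have [muk [mu0 cmu [D D0 HD]]] := mu_asymptotics R hk.
have [sigma [sg0 csg [E E0 HE]]] := variance_asymptotics R hk.
exists muk, sigma; split => //.
exact: (zagreb_clt hk sg0 D0 E0 HD HE).
Qed.
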